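(* Let $(M^{2n},\omega,\varphi)$ be a Calabi-Yau manifold with a Hamiltonian structure-preserving action of the torus $T=T^{n-1}$ with moment map $\mu$, and suppose $H^1(M,\mathbb{R})=0$. Let $\xi:M\to\mathbb{R}$ be the function defined (up to a constant) by $d\xi=\mathrm{Im}\,\varphi'$, where $\varphi'=i_{X_1}\cdots i_{X_{n-1}}\varphi$. Suppose that the set of non-regular points of the $T$-action on $M$ is a finite union $S=\bigcup S_i$ of connected submanifolds such that each $S_i$ has a positive-dimensional stabilizer $T_i\subset T$. Then there is a finite union $H=\bigcup H_i$ of $(n-2)$-dimensional affine planes in $\mathbb{R}^n$ such that for all points $p\in\mathbb{R}^n$ outside $H$, the fiber $(\mu,\xi)^{-1}(p)$ is a smooth SLag submanifold of $M$.
   Context: A Calabi-Yau manifold $(M^{2n},\omega,\varphi)$ here means a Kähler manifold $(M,\omega)$ of complex dimension $n$ with a nowhere vanishing holomorphic $(n,0)$-form $\varphi$ (no Ricci-flatness required). A Special Lagrangian (SLag) submanifold is a submanifold $L$ of real dimension $n$ with $\omega|_L=0$ and $\mathrm{Im}\,\varphi|_L=0$. A torus action is structure-preserving if it preserves $\omega$ and $\varphi$. It is assumed that no nontrivial element of the torus acts trivially. Let $\mathcal{G}$ be the Lie algebra of $T$, and for $v\in\mathcal{G}$ let $X_v$ be the induced vector field on $M$. The moment map is a $T$-invariant map $\mu:M\to\mathcal{G}^*$ with $d(\mu(v))=i_{X_v}\omega$ for all $v$. Fix a basis $v_1,\dots,v_{n-1}$ of $\mathcal{G}$, let $X_i=X_{v_i}$,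 and use it to identify $\mathcal{G}^*$ with $\mathbb{R}^{n-1}$, so that $(\mu,\xi):M\to\mathbb{R}^n$. The form $\varphi'=i_{X_1}\cdots i_{X_{n-1}}\varphi$ is a closed holomorphic $(1,0)$-form, so, as $H^1(M,\mathbb{R})=0$, there is a holomorphic function $f$ with $df=\varphi'$, and $\xi=\mathrm{Im}\,f$. A point $m$ is regular for the action if $v\mapsto X_v(m)$ is injective on $\mathcal{G}$, and non-regular otherwise. That $S_i$ has stabilizer $T_i$ means that $T_i$ fixes every point of $S_i$. *)

(* Defs.v *)
From HB Require Import structures.
From mathcomp Require Import all_boot all_order all_algebra.
From mathcomp Require Import complex.
From mathcomp Require Import all_classical all_reals all_analysis.
Set Implicit Arguments.
Unset Strict Implicit.
Unset Printing Implicit Defensive.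
Import Order.TTheory GRing.Theory Num.Theory.
Import numFieldNormedType.Exports.
Local Open Scope classical_set_scope.
Local Open Scope ring_scope.

(** * Smooth and holomorphic maps between coordinate spaces *)

(* C^k on an open set [U], by recursion on the iterated directional
   derivatives; only ever used with [U] open and [V] finite-dimensional. *)
Fixpoint Ck_on {R : realType} {V W : normedModType R} (k : nat)
    (U : set V) (f : V -> W) : Prop :=
  if k is k'.+1 then
    (forall x, U x -> differentiable f x) /\
    (forall v, Ck_on k' U (fun x => 'D_v f x))
  else forall x, U x -> {for x, continuous f}.

Definition smooth_on {R : realType} {V W : normedModType R}
    (U : set V) (f : V -> W) : Prop := forall k, Ck_on k U f.

(* C^n is 'rV[R]_(n + n), with z = x + iy stored as the row (x, y);
   [mulI] is multiplication by i. *)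
Definition mulI {R : realType} {n : nat} (v : 'rV[R]_(n + n))
    : 'rV[R]_(n + n) :=
  row_mx (- rsubmx v) (lsubmx v).

(* Smooth, with complex-linear differential. *)
Definition holomorphic_on {R : realType} {n k : nat}
    (U : set 'rV[R]_(n + n)) (f : 'rV[R]_(n + n) -> 'rV[R]_(k + k)) : Prop :=
  smooth_on U f /\
  forall x, U x -> forall w, 'D_(mulI w) f x = mulI ('D_w f x).

(* Same notion for complex-valued functions (Cauchy-Riemann equations). *)
Definition holomorphic_fun_on {R : realType} {n : nat}
    (U : set 'rV[R]_(n + n)) (g : 'rV[R]_(n + n) -> R[i]) : Prop :=
  let u := fun x => complex.Re (g x) in
  let v := fun x => complex.Im (g x) in
  [/\ smooth_on U u, smooth_on U v &
      forall x, U x -> forall w,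
        'D_(mulI w) u x = - 'D_w v x /\ 'D_(mulI w) v x = 'D_w u x].

(** * Charts and complex manifolds *)

(* A homeomorphism from an open set of [M] to an open set of [E]; [chart_fun]
   and [chart_inv] are total, with irrelevant values outside these sets. *)
Record chart (E M : topologicalType) := Chart {
  chart_dom : set M ;
  chart_cod : set E ;
  chart_fun :> M -> E ;
  chart_inv : E -> M ;
  chart_dom_open : open chart_dom ;
  chart_cod_open : open chart_cod ;
  chart_funS : forall p, chart_dom p -> chart_cod (chart_fun p) ;
  chart_invS : forall x, chart_cod x -> chart_dom (chart_inv x) ;
  chart_funK : forall p, chart_dom p -> chart_inv (chart_fun p) = p ;
  chart_invK : forall x, chart_cod x -> chart_fun (chart_inv x) = x ;
  chart_fun_cont : forall p, chart_dom p -> {for p, continuous chart_fun} ;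
  chart_inv_cont : forall x, chart_cod x -> {for x, continuous chart_inv}
}.

Definition overlap {E M : topologicalType} (c d : chart E M) : set E :=
  [set x | chart_cod c x /\ chart_dom d (chart_inv c x)].

Definition transition {E M : topologicalType} (c d : chart E M) : E -> E :=
  fun x => d (chart_inv c x).

Record complexManifold (R : realType) (n : nat) := ComplexManifold {
  cm_space :> topologicalType ;
  cm_hausdorff : hausdorff_space cm_space ;
  cm_second_countable : @second_countable cm_space ;
  atlas_index : Type ;
  atlas : atlas_index -> chart 'rV[R]_(n + n) cm_space ;
  index_at : cm_space -> atlas_index ;
  index_atP : forall p, chart_dom (atlas (index_at p)) p ;
  atlas_compat : forall i j,
    holomorphic_on (overlap (atlas i) (atlas j))
                   (transition (atlas i) (atlas j))
}.

(** * Tangent vectors and differentials *)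

(* The tangent space T_pM is identified with 'rV[R]_(n + n) by means of the
   preferred chart [chart_at p]; as the transition maps are holomorphic, the
   complex structure of T_pM is [mulI] whatever the chart. *)
Definition chart_at {R : realType} {n : nat} {M : complexManifold R n} (p : M)
  : chart 'rV[R]_(n + n) M := atlas (index_at p).

Section Tangent.
Context {R : realType} {n : nat} {M : complexManifold R n}.
Local Notation E := 'rV[R]_(n + n).

Definition smooth_fun (f : M -> R) : Prop :=
  forall i : atlas_index M,
    smooth_on (chart_cod (atlas i)) (fun x => f (chart_inv (atlas i) x)).

Definition diff_fun (f : M -> R) (p : M) (w : E) : R :=
  'D_w (fun x => f (chart_inv (chart_at p) x)) (chart_at p p).

Definition diff_map (F : M -> M) (p : M) (w : E) : E :=
  'D_w (fun x => chart_at (F p) (F (chart_inv (chart_at p) x))) (chart_at p p).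

(* The tangent vector at [chart_inv (atlas i) x] whose coordinates in the
   chart [atlas i] are [w]. *)
Definition tangent_of_coord (i : atlas_index M) (x w : E) : E :=
  'D_w (transition (atlas i) (chart_at (chart_inv (atlas i) x))) x.

(** * Differential forms *)

Definition multilinear {k : nat} (a : ('I_k -> E) -> R) : Prop :=
  forall (v : 'I_k -> E) (l : 'I_k) (c : R) (x y : E),
    a (dfwith v l (c *: x + y)) = c * a (dfwith v l x) + a (dfwith v l y).

Definition alternating {k : nat} (a : ('I_k -> E) -> R) : Prop :=
  forall (v : 'I_k -> E) (l l' : 'I_k), l != l' -> v l = v l' -> a v = 0.

(* Coordinate expression, in the chart [atlas i] at [x], of a field of
   k-forms with values in [T]. *)
Definition local_form {T : Type} {k : nat} (a : M -> ('I_k -> E) -> T)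
    (i : atlas_index M) (x : E) (v : 'I_k -> E) : T :=
  a (chart_inv (atlas i) x) (fun l => tangent_of_coord i x (v l)).

Definition differential_form {k : nat} (a : M -> ('I_k -> E) -> R) : Prop :=
  [/\ forall p, multilinear (a p),
      forall p, alternating (a p) &
      forall i v, smooth_on (chart_cod (atlas i)) (fun x => local_form a i x v)].

(* Exterior derivative in the chart [atlas i], evaluated on vectors with
   constant coordinates, so that no bracket term appears. *)
Definition ext_deriv {k : nat} (a : M -> ('I_k -> E) -> R)
    (i : atlas_index M) (x : E) (v : 'I_k.+1 -> E) : R :=
  \sum_(l < k.+1) (-1) ^+ l *
    'D_(v l) (fun y => local_form a i y (fun j => v (lift l j))) x.

Definition closed_form {k : nat} (a : M -> ('I_k -> E) -> R) : Prop :=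
  forall i x v, chart_cod (atlas i) x -> ext_deriv a i x v = 0.

Definition kahler_form (omega : M -> ('I_2 -> E) -> R) : Prop :=
  [/\ differential_form omega,
      closed_form omega,
      forall p (v w : E), omega p (tnth [tuple mulI v; mulI w])
                    = omega p (tnth [tuple v; w]) &
      forall p (v : E), v != 0 -> 0 < omega p (tnth [tuple v; mulI v])].

(* Nowhere vanishing holomorphic (n,0)-form. *)
Definition holomorphic_volume_form (phi : M -> ('I_n -> E) -> R[i]) : Prop :=
  [/\ differential_form (fun p v => complex.Re (phi p v)) /\
        differential_form (fun p v => complex.Im (phi p v)),
      forall p v l, phi p (dfwith v l (mulI (v l))) = 'i%C * phi p v,
      forall i v, holomorphic_fun_on (chart_cod (atlas i))
                    (fun x => local_form phi i x v) &
      forall p, exists v, phi p v != 0].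

(** * Submanifolds *)

Definition smooth_chart (c : chart E M) : Prop :=
  forall i : atlas_index M,
    smooth_on (overlap c (atlas i)) (transition c (atlas i)) /\
    smooth_on (overlap (atlas i) c) (transition (atlas i) c).

(* Embedded submanifold of real dimension [k]: near each of its points, [L] is
   the slice x_k = ... = x_{2n-1} = 0 of a smooth chart.  The empty set
   qualifies, and [L] need not be closed in [M]. *)
Definition submanifold (k : nat) (L : set M) : Prop :=
  (k <= n + n)%N /\
  forall p, L p -> exists c : chart E M,
    [/\ chart_dom c p, smooth_chart c &
        forall q, chart_dom c q ->
          (L q <-> forall j : 'I_(n + n), (k <= j)%N -> c q 0 j = 0)].

Definition smooth_curve (U : set R) (g : R -> M) : Prop :=
  (forall t, U t -> {for t, continuous g}) /\
  forall i : atlas_index M,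
    smooth_on (U `&` g @^-1` chart_dom (atlas i)) (fun t => atlas i (g t)).

(* [w] belongs to T_pL: it is the velocity of a smooth curve in [L]. *)
Definition tangent_to (L : set M) (p : M) (w : E) : Prop :=
  exists (e : R) (g : R -> M),
    [/\ 0 < e, smooth_curve [set t | `|t| < e] g,
        forall t, `|t| < e -> L (g t),
        g 0 = p &
        derive1 (fun t => chart_at p (g t)) 0 = w].

Definition special_lagrangian (omega : M -> ('I_2 -> E) -> R)
    (phi : M -> ('I_n -> E) -> R[i]) (L : set M) : Prop :=
  [/\ submanifold n L,
      forall p v, L p -> (forall l : 'I_2, tangent_to L p (v l)) ->
        omega p v = 0 &
      forall p v, L p -> (forall l : 'I_n, tangent_to L p (v l)) ->
        complex.Im (phi p v) = 0].

(* H^1(M, R) = 0, in de Rham cohomology. *)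
Definition H1_vanishes : Prop :=
  forall a : M -> ('I_1 -> E) -> R, differential_form a -> closed_form a ->
    exists2 f : M -> R, smooth_fun f &
      forall p v, a p v = diff_fun f p (v ord0).

End Tangent.

Arguments H1_vanishes {R n} M.

(** * Torus actions *)

Definition integer_lattice {R : realType} {m : nat} : set 'rV[R]_m :=
  [set t | forall j, t 0 j \is a Num.int].

(* T^m is R^m / Z^m, with Lie algebra R^m and the quotient map as exponential;
   a smooth action of T^m is given as a smooth action of R^m which is trivial
   on Z^m. *)
Record torusAction (R : realType) (m n : nat) (M : complexManifold R n) :=
  TorusAction {
  act :> 'rV[R]_m -> M -> M ;
  act0 : forall p, act 0 p = p ;
  actD : forall s t p, act (s + t) p = act s (act t p) ;
  act_lattice : forall t p, integer_lattice t -> act t p = p ;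
  act_continuous : continuous (fun tp : 'rV[R]_m * M => act tp.1 tp.2) ;
  act_smooth : forall i j : atlas_index M,
    smooth_on
      [set tx : 'rV[R]_m * 'rV[R]_(n + n) |
        chart_cod (atlas i) tx.2 /\
        chart_dom (atlas j) (act tx.1 (chart_inv (atlas i) tx.2))]
      (fun tx => atlas j (act tx.1 (chart_inv (atlas i) tx.2)))
}.

Section Action.
Context {R : realType} {m n : nat} {M : complexManifold R n}.
Local Notation E := 'rV[R]_(n + n).
Variable a : torusAction m M.

(* No nontrivial element of the torus acts trivially. *)
Definition effective : Prop :=
  forall t, (forall p, a t p = p) -> integer_lattice t.

Definition preserves {T : Type} {k : nat} (b : M -> ('I_k -> E) -> T) : Prop :=
  forall t p v, b (a t p) (fun l => diff_map (a t) p (v l)) = b p v.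

Definition induced_field (v : 'rV[R]_m) (p : M) : E :=
  derive1 (fun s : R => chart_at p (a (s *: v) p)) 0.

Definition regular_point (p : M) : Prop :=
  injective (fun v : 'rV[R]_m => induced_field v p).

(* [mu p v] is the value at [p] of the component of the moment map along [v]. *)
Definition moment_map (omega : M -> ('I_2 -> E) -> R)
    (mu : M -> 'Hom('rV[R]_m, R^o)) : Prop :=
  [/\ forall t p, mu (a t p) = mu p,
      forall v, smooth_fun (fun p => mu p v : R) &
      forall v p w, diff_fun (fun q => mu q v : R) p w
                    = omega p (tnth [tuple induced_field v p; w])].

(* A closed subgroup of T^m, given by its preimage [K] in R^m, fixing every
   point of [A]. *)
Definition stabilizing_subgroup (A : set M) (K : set 'rV[R]_m) : Prop :=
  [/\ closed K, integer_lattice `<=` K,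
      forall s t, K s -> K t -> K (s - t) &
      forall t p, K t -> A p -> a t p = p].

(* The Lie algebra {v | exp (s v) in K for all s} is nonzero. *)
Definition positive_dimensional (K : set 'rV[R]_m) : Prop :=
  exists2 v : 'rV[R]_m, v != 0 & forall s : R, K (s *: v).

End Action.

(* i_{X_1} ... i_{X_m} phi for X_j the field induced by [b_j].  The innermost
   contraction is by X_m and each contraction fills the first free slot, so
   the value on [w] is phi(X_m, ..., X_1, w). *)
Definition contracted_form {R : realType} {m : nat} {M : complexManifold R m.+1}
    (a : torusAction m M) (b : m.-tuple 'rV[R]_m)
    (phi : M -> ('I_m.+1 -> 'rV[R]_(m.+1 + m.+1)) -> R[i])
    (p : M) (w : 'rV[R]_(m.+1 + m.+1)) : R[i] :=
  phi p (fun k => if unlift ord_max k is Some j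
                  then induced_field a (tnth b (rev_ord j)) p else w).

(* (mu, xi) : M -> R^(m+1), the dual of the Lie algebra being identified with
   R^m by evaluation on the basis [b]. *)
Definition moment_xi {R : realType} {m : nat} {M : complexManifold R m.+1}
    (b : m.-tuple 'rV[R]_m) (mu : M -> 'Hom('rV[R]_m, R^o)) (xi : M -> R)
    (p : M) : 'rV[R]_m.+1 :=
  \row_(k < m.+1) if unlift ord_max k is Some j then mu p (tnth b j) else xi p.

Definition affine_plane {R : realType} {k : nat} (d : nat)
    (P : set 'rV[R]_k) : Prop :=
  exists (x0 : 'rV[R]_k) (W : {vspace 'rV[R]_k}),
    \dim W = d /\ P = [set x | x - x0 \in W].

(* Main.v *)
Require Import Defs.
From HB Require Import structures.
From mathcomp Require Import all_boot all_order all_algebra.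
From mathcomp Require Import fingroup perm complex.
From mathcomp Require Import ring lra.
From mathcomp Require Import all_classical all_reals all_analysis.
Import Order.TTheory GRing.Theory Num.Theory.
Import numFieldNormedType.Exports.
Local Open Scope classical_set_scope.
Local Open Scope ring_scope.

(** The one-form [alpha] obtained by contracting [phi] with the orbit fields
    [X_1, ..., X_m] is complex linear, and [d xi = Im alpha], while
    [d (mu v) = omega (X_v, _)]. By invariance of [mu] the [X_j] span an
    isotropic space, and by positivity of [omega (u, J u)] an isotropic family
    that is independent over the reals is independent over the complex numbers.

    Regular points. If the [X_j] are independent at [q], their complex span is a
    complex hyperplane and it is exactly the kernel of [alpha]. The vectors
    [J X_j] are annihilated by [d xi] and separate the [d (mu v)], so that the
    differential of [(mu, xi)] is onto ([differentials_free]). On its kernel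
    [alpha] is real valued; hence that kernel is spanned by the [X_j] and one
    more vector, which makes it isotropic for [omega] and [Im phi] vanish on it
    ([kernel_isotropic], [kernel_special]). The inverse function theorem turns
    surjectivity into slice charts of the fiber ([regular_level_submanifold]),
    whose tangent vectors lie in the kernel.

    Non-regular points. If [S] is fixed by the one-parameter group of [v != 0],
    then [X_v = 0] on [S], so both [d (mu v)] and [d xi] vanish at the points of
    [S]. Being connected, [S] is mapped by [(mu, xi)] into the affine plane of
    codimension two on which the linear form [v] and the last coordinate are
    constant ([fixed_submanifold_image]). A fiber over a point outside these
    planes therefore consists of regular points. *)

Set Implicit Arguments.
Unset Strict Implicit.
Unset Printing Implicit Defensive.

(** * Calculus of C^k maps *)

Section Differentiability.
Context {R : realType} {V W : normedModType R}.

Lemma differentiable_le_eps (f : V -> W) (x : V) :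
  differentiable f x -> forall e : R, 0 < e ->
  \forall y \near x, `|f y - f x - 'd f x (y - x)| <= e * `|y - x|.
Proof.
move=> df e e0.
have [_ /eqaddoP/(_ e e0)] := (diff_locallyP x f).1 df.
move=> /nbhs_norm0P[d /= d0 H]; apply/nbhs_normP; exists d => //= y /= yx.
have /= := H (y - x); rewrite distrC => /(_ yx).
by rewrite !fctE /= subrK opprD addrA.
Qed.

Lemma differentiable_of_le_eps (f : V -> W) (x : V) (L : {linear V -> W}) :
  continuous L ->
  (forall e : R, 0 < e ->
    \forall y \near x, `|f y - f x - L (y - x)| <= e * `|y - x|) ->
  differentiable f x /\ 'd f x = L :> (V -> W).
Proof.
move=> cL H.
have fE : f \o shift x = cst (f x) + L +o_ (0 : V) id.
  apply/eqaddoP => e e0.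
  have /nbhs_normP[d /= d0 {}H] := H _ e0.
  apply/nbhs_norm0P; exists d => //= h /= hd.
  have /= := H (h + x); rewrite addrK distrC addrK => /(_ hd).
  by rewrite !fctE /= opprD addrA.
have dE := diff_unique cL fE.
by split => //; apply/diff_locallyP; rewrite dE.
Qed.

Lemma near_eq_differentiable (f g : V -> W) (x : V) :
  (\forall y \near x, f y = g y) -> differentiable f x -> differentiable g x.
Proof.
move=> fg df.
apply: (differentiable_of_le_eps (L := 'd f x) _ _).1.
  exact: diff_continuous.
move=> e e0; have H := differentiable_le_eps df e0.
near=> y; rewrite -(near fg y)// -(nbhs_singleton fg).
by near: y.
Unshelve. all: by end_near. Qed.

End Differentiability.

Section CkCalculus.
Context {R : realType} {V : normedModType R}.
Implicit Types (U : set V) (k : nat).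

Lemma Ck_on_sub {W : normedModType R} k U U' (f : V -> W) :
  U' `<=` U -> Ck_on k U f -> Ck_on k U' f.
Proof.
move=> UU'; elim: k f => [|k IH] f /=; first by move=> H x /UU'; exact: H.
by move=> [df Df]; split=> [x /UU'|v]; [exact: df|exact: IH].
Qed.

Lemma eq_Ck_on {W : normedModType R} k U (f g : V -> W) : open U ->
  (forall x, U x -> f x = g x) -> Ck_on k U f -> Ck_on k U g.
Proof.
move=> oU; elim: k f g => [|k IH] f g fg /=.
  move=> H x Ux; have fx := H x Ux.
  rewrite /prop_for /continuous_at -(fg _ Ux); apply: cvg_trans fx.
  apply: near_eq_cvg; near=> y; apply: fg; near: y.
  exact: open_nbhs_nbhs.
have near_fg x : U x -> \forall y \near x, f y = g y.
  move=> Ux; near=> y; apply: fg; near: y; exact: open_nbhs_nbhs.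
move=> [df Df]; split=> [x Ux|v].
  by apply: near_eq_differentiable (df x Ux); exact: near_fg.
by apply: IH (Df v) => x Ux; apply: near_eq_derive; exact: near_fg.
Unshelve. all: by end_near. Qed.

Lemma Ck_on_continuous {W : normedModType R} k U (f : V -> W) x :
  Ck_on k U f -> U x -> {for x, continuous f}.
Proof.
by case: k => [|k] /= => [H /H //|[df _] /df]; exact: differentiable_continuous.
Qed.

Lemma Ck_onW {W : normedModType R} k U (f : V -> W) :
  Ck_on k.+1 U f -> Ck_on k U f.
Proof.
elim: k f => [|k IH] f H.
  by move=> x Ux; exact: Ck_on_continuous H Ux.
by case: H => df Df; split => // v; exact: IH.
Qed.

Lemma Ck_on_cst {W : normedModType R} k U (w : W) : Ck_on k U (cst w).
Proof.
elim: k w => [|k IH] w /=; first by move=> x _; exact: cst_continuous.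
split=> [x _|v]; first exact: differentiable_cst.
rewrite (_ : (fun x => _) = cst (0 : W)); first exact: IH.
by apply/funext => x; rewrite derive_cst.
Qed.

Lemma Ck_onD {W : normedModType R} k U (f g : V -> W) : open U ->
  Ck_on k U f -> Ck_on k U g -> Ck_on k U (f + g).
Proof.
move=> oU; elim: k f g => [|k IH] f g /=.
  by move=> cf cg x Ux; apply: continuousD; [exact: cf|exact: cg].
move=> [df Df] [dg Dg]; split=> [x Ux|v].
  by apply: differentiableD; [exact: df|exact: dg].
apply: (eq_Ck_on oU _ (IH _ _ (Df v) (Dg v))) => x Ux.
by rewrite deriveD//; apply: diff_derivable; [exact: df|exact: dg].
Qed.

Lemma Ck_on_sum {W : normedModType R} {I : Type} (s : seq I) (P : pred I) k U
    (f : I -> V -> W) : open U ->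
  (forall i, P i -> Ck_on k U (f i)) ->
  Ck_on k U (fun x => \sum_(i <- s | P i) f i x).
Proof.
move=> oU H; elim: s => [|i s IH].
  rewrite (_ : (fun x => _) = cst 0) ?funeqE => [|x]; rewrite ?big_nil//.
  exact: Ck_on_cst.
case: (boolP (P i)) => Pi; last first.
  by apply: (eq_Ck_on oU _ IH) => x _; rewrite big_cons (negbTE Pi).
apply: (eq_Ck_on oU _ (Ck_onD oU (H i Pi) IH)) => x _.
by rewrite big_cons Pi.
Qed.

Lemma Ck_on_scalel {W : normedModType R} k U (f : V -> R) (w : W) : open U ->
  Ck_on k U f -> Ck_on k U (fun x => f x *: w).
Proof.
move=> oU; elim: k f => [|k IH] f /=.
  move=> cf x Ux; apply: cvgZr_tmp; exact: cf.
move=> [df Df]; split=> [x Ux|v]; first exact/differentiableZl/df.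
apply: (eq_Ck_on oU _ (IH _ (Df v))) => x Ux.
rewrite !deriveE ?diffZl//; [exact: df|exact/differentiableZl/df|exact: df].
Qed.

Lemma Ck_onM k U (f g : V -> R) : open U ->
  Ck_on k U f -> Ck_on k U g -> Ck_on k U (f \* g).
Proof.
move=> oU; elim: k f g => [|k IH] f g.
  by move=> cf cg x Ux; apply: continuousM; [exact: cf|exact: cg].
move=> Cf Cg; have [df Df] := Cf; have [dg Dg] := Cg; split=> [x Ux|v].
  by apply: differentiableM; [exact: df|exact: dg].
have Cfg := Ck_onD oU (IH _ _ (Ck_onW Cf) (Dg v)) (IH _ _ (Ck_onW Cg) (Df v)).
apply: (eq_Ck_on oU _ Cfg) => x Ux.
by rewrite deriveM//; apply: diff_derivable; [exact: df|exact: dg].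
Qed.

Lemma Ck_on_prod {I : Type} (s : seq I) k U (f : I -> V -> R) : open U ->
  (forall i, Ck_on k U (f i)) -> Ck_on k U (fun x => \prod_(i <- s) f i x).
Proof.
move=> oU H; elim: s => [|i s IH].
  rewrite (_ : (fun x => _) = cst 1) ?funeqE => [|x]; rewrite ?big_nil//.
  exact: Ck_on_cst.
apply: (eq_Ck_on oU _ (Ck_onM oU (H i) IH)) => x _.
by rewrite big_cons.
Qed.

Lemma Ck_onV k U (f : V -> R) : open U -> (forall x, U x -> f x != 0) ->
  Ck_on k U f -> Ck_on k U (fun x => (f x)^-1).
Proof.
move=> oU f0; elim: k => [|k IH] Cf.
  by move=> x Ux; apply: continuousV; [exact: f0|exact: Cf].
have CV := IH (Ck_onW Cf); have [df Df] := Cf; split=> [x Ux|v].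
  by apply: differentiableV; [exact: df|exact: f0].
have C1 := Ck_onM oU (Ck_on_cst k U (-1 : R))
  (Ck_onM oU (Ck_onM oU CV CV) (Df v)).
apply: (eq_Ck_on oU _ C1) => x Ux.
rewrite deriveV//; last by apply: diff_derivable; exact: df.
  by rewrite /= mulN1r scaleNr expr2 invfM.
exact: f0.
Qed.

Lemma Ck_on_det n k U (A : V -> 'M[R]_n) : open U ->
  (forall i j, Ck_on k U (fun x => A x i j)) -> Ck_on k U (fun x => \det (A x)).
Proof.
move=> oU CA; apply: Ck_on_sum => // s _.
by apply: Ck_onM => //; [exact: Ck_on_cst|exact: Ck_on_prod].
Qed.

Lemma Ck_on_invmx n k U (A : V -> 'M[R]_n) i j : open U ->
  (forall x, U x -> A x \in unitmx) ->
  (forall i j, Ck_on k U (fun x => A x i j)) ->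
  Ck_on k U (fun x => invmx (A x) i j).
Proof.
move=> oU uA CA.
have Cdet := Ck_on_det oU CA.
have CV : Ck_on k U (fun x => (\det (A x))^-1).
  by apply: Ck_onV => // x /uA; rewrite unitmxE unitfE.
have Cadj : Ck_on k U (fun x => \adj (A x) i j).
  have Cd : Ck_on k U (fun x => (-1) ^+ (j + i) * \det (row' j (col' i (A x)))).
    apply: Ck_onM => //; first exact: Ck_on_cst.
    apply: Ck_on_det => // a b.
    apply: (eq_Ck_on oU _ (CA (lift j a) (lift i b))).
    by move=> x _; rewrite !mxE.
  by apply: (eq_Ck_on oU _ Cd) => x _; rewrite mxE.
apply: (eq_Ck_on oU _ (Ck_onM oU CV Cadj)) => x Ux.
by rewrite /invmx uA// mxE.
Qed.

Lemma derive_coord m n (f : V -> 'M[R]_(m, n)) x v i j : differentiable f x ->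
  'D_v (fun y => f y i j) x = 'D_v f x i j.
Proof. by move=> df; rewrite derive_mx ?mxE//; exact: diff_derivable. Qed.

Lemma Ck_on_rowP n k U (f : V -> 'rV[R]_n) : open U ->
  Ck_on k U f <-> forall j, Ck_on k U (fun x => f x 0 j).
Proof.
move=> oU; split=> [|Cf].
  elim: k f => [|k IH] f /=.
    move=> cf j x Ux; apply: (@continuous_comp _ _ _ f (fun y => y 0 j)).
      exact: cf.
    exact: coord_continuous.
  move=> [df Df] j; split=> [x Ux|v].
    apply: (differentiable_comp (g := fun y : 'rV[R]_n => y 0 j)).
      exact: df.
    exact: differentiable_coord.
  apply: (eq_Ck_on oU _ (IH _ (Df v) j)) => x Ux.
  by rewrite derive_coord//; exact: df.
have CS : Ck_on k U
    (fun x => \sum_(j < n) f x 0 j *: (delta_mx 0 j : 'rV[R]_n)).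
  by apply: Ck_on_sum => // j _; exact: Ck_on_scalel.
by apply: (eq_Ck_on oU _ CS) => x _; rewrite -row_sum_delta.
Qed.

End CkCalculus.

Section Composition.
Context {R : realType}.

Lemma derive_comp {V W Z : normedModType R} (f : V -> W) (g : W -> Z) x v :
  differentiable f x -> differentiable g (f x) ->
  'D_v (g \o f) x = 'D_('D_v f x) g (f x).
Proof.
move=> df dg; have dgf := differentiable_comp df dg.
by rewrite (deriveE v dgf) (diff_comp df dg) /= (deriveE v df) (deriveE _ dg).
Qed.

Lemma derive_row_sum {W : normedModType R} n (g : 'rV[R]_n -> W) y w :
  differentiable g y ->
  'D_w g y = \sum_(j < n) w 0 j *: 'D_(delta_mx 0 j) g y.
Proof.
move=> dg; rewrite (deriveE _ dg) [in LHS](row_sum_delta w) linear_sum.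
by apply: eq_bigr => j _; rewrite linearZ (deriveE _ dg).
Qed.

(** The chain rule expresses the derivatives of [g \o f] through products of
    those of [f] with compositions of the derivatives of [g] with [f], to
    which the induction hypothesis applies. *)
Lemma Ck_on_comp_real {V : normedModType R} n k (U : set V) (U' : set 'rV[R]_n)
    (f : V -> 'rV[R]_n) (g : 'rV[R]_n -> R) : open U ->
  (forall x, U x -> U' (f x)) ->
  Ck_on k U f -> Ck_on k U' g -> Ck_on k U (g \o f).
Proof.
move=> oU UU'; elim: k f g UU' => [|k IH] f g UU' /=.
  move=> cf cg x Ux; apply: continuous_comp; first exact: cf.
  by apply: cg; exact: UU'.
move=> Cf [dg Dg]; have [df Df] := Cf; split=> [x Ux|v].
  by apply: differentiable_comp; [exact: df|exact/dg/UU'].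
have CS : Ck_on k U
    (fun x => \sum_(j < n) 'D_v f x 0 j * 'D_(delta_mx 0 j) g (f x)).
  apply: Ck_on_sum => // j _; apply: Ck_onM => //.
    exact: (Ck_on_rowP _ _ oU).1 (Df v) j.
  exact: (IH f (fun y => 'D_(delta_mx 0 j) g y) UU' (Ck_onW Cf) (Dg _)).
apply: (eq_Ck_on oU _ CS) => x Ux.
have dgx := dg _ (UU' x Ux).
by rewrite (derive_comp v (df x Ux) dgx) (derive_row_sum _ dgx).
Qed.

Lemma Ck_on_comp {V : normedModType R} n p k (U : set V)
    (U' : set 'rV[R]_n) (f : V -> 'rV[R]_n) (g : 'rV[R]_n -> 'rV[R]_p) :
  open U -> open U' -> (forall x, U x -> U' (f x)) ->
  Ck_on k U f -> Ck_on k U' g -> Ck_on k U (g \o f).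
Proof.
move=> oU oU' UU' Cf Cg; apply/Ck_on_rowP => // j.
exact: Ck_on_comp_real oU UU' Cf ((Ck_on_rowP k g oU').1 Cg j).
Qed.

Lemma smooth_on_comp {V : normedModType R} n p (U : set V)
    (U' : set 'rV[R]_n) (f : V -> 'rV[R]_n) (g : 'rV[R]_n -> 'rV[R]_p) :
  open U -> open U' -> (forall x, U x -> U' (f x)) ->
  smooth_on U f -> smooth_on U' g -> smooth_on U (g \o f).
Proof. by move=> oU oU' UU' sf sg k; exact: (Ck_on_comp oU oU' UU'). Qed.

End Composition.

(** * The inverse function theorem *)

Section InverseFunction.
Context {R : realType}.

Lemma mx_norm_coord m n (A : 'M[R]_(m, n)) i j : `|A i j| <= `|A|.
Proof.
rewrite [leRHS]/Num.Def.normr /= mx_normrE.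
exact: (le_bigmax _ (fun ij : 'I_m * 'I_n => `|A ij.1 ij.2|) (i, j)).
Qed.

Lemma mx_norm_le m n (A : 'M[R]_(m, n)) (c : R) : 0 <= c ->
  (forall i j, `|A i j| <= c) -> `|A| <= c.
Proof.
by move=> c0 H; rewrite [leLHS]/Num.Def.normr /= mx_normrE bigmax_le.
Qed.

Lemma derive_line {V : normedModType R} (x w : V) (t : R) :
  differentiable (fun s : R => x + s *: w) t /\
  'D_1 (fun s : R => x + s *: w) t = w.
Proof.
have dw : differentiable (fun s : R => s *: w) t.
  by apply: (@differentiableZl _ _ _ id w t); exact: ex_diff.
have dx : differentiable (cst x : R -> V) t by exact: differentiable_cst.
have dl : differentiable (fun s : R => x + s *: w) t.
  exact: (differentiableD dx dw).
split=> //.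
rewrite (deriveE _ dl) (diffD dx dw) diff_cst /= add0r.
rewrite (@diffZl _ _ _ id w t); last exact: ex_diff.
by rewrite diff_val scale1r.
Qed.

Lemma derive_along_line {V W : normedModType R} (f : V -> W) (x w : V) (t : R) :
  differentiable f (x + t *: w) ->
  differentiable (fun s : R => f (x + s *: w)) t /\
  'D_1 (fun s : R => f (x + s *: w)) t = 'D_w f (x + t *: w).
Proof.
move=> df; have [dl Dl] := derive_line x w t; split.
  exact: (differentiable_comp dl).
by rewrite (derive_comp (f := fun s : R => x + s *: w) 1 dl df) Dl.
Qed.

Lemma mean_value {V : normedModType R} (f : V -> R) (x y : V) :
  (forall t : R, 0 <= t <= 1 -> differentiable f (x + t *: (y - x))) ->
  exists2 t : R, 0 <= t <= 1 & f y - f x = 'D_(y - x) f (x + t *: (y - x)).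
Proof.
move=> df; pose g := fun s : R => f (x + s *: (y - x)).
have dg (t : R) : 0 <= t <= 1 ->
    differentiable g t /\ 'D_1 g t = 'D_(y - x) f (x + t *: (y - x)).
  by move=> /df; exact: derive_along_line.
have [| |t t01] := @MVT_segment _ g (fun t => 'D_1 g t) 0 1 ler01.
- move=> t; rewrite in_itv /= => /andP[t0 t1].
  have [|dgt _] := dg t; first by rewrite !ltW.
  by apply: DeriveDef => //; exact: diff_derivable.
- apply: continuous_in_subspaceT => t; rewrite inE /= in_itv /=.
  by move=> /dg[dgt _]; exact: differentiable_continuous.
rewrite in_itv /= in t01.
have -> : f y = g 1 by rewrite /g scale1r addrC subrK.
have -> : f x = g 0 by rewrite /g scale0r addr0.
by rewrite subr0 mulr1 (dg t t01).2 => ->; exists t.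
Qed.

Lemma ball_segment {V : normedModType R} (c x y : V) (r t : R) :
  ball c r x -> ball c r y -> 0 <= t <= 1 -> ball c r (x + t *: (y - x)).
Proof.
rewrite -ball_normE /= => cx cy /andP[t0 t1].
have -> : c - (x + t *: (y - x)) = (1 - t) *: (c - x) + t *: (c - y).
  rewrite scalerBl scale1r -addrA [- _ + _]addrC -scalerBr opprB.
  by rewrite [c - y + _]addrC subrKA opprD addrA -scalerN opprB.
apply: le_lt_trans (ler_normD _ _) _.
rewrite !normrZ (ger0_norm t0) ger0_norm ?subr_ge0//.
have [->|tn0] := eqVneq t 0; first by rewrite subr0 mul1r mul0r addr0.
have tp : 0 < t by rewrite lt_def tn0.
have -> : r = (1 - t) * r + t * r by rewrite -mulrDl subrK mul1r.
apply: ler_ltD; first by rewrite ler_wpM2l ?subr_ge0// ltW.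
by rewrite ltr_pM2l.
Qed.

Lemma mean_value_le {V : normedModType R} n (f : V -> 'rV[R]_n) (x0 : V) r c :
  0 <= c -> (forall x, ball x0 r x -> differentiable f x) ->
  (forall x v, ball x0 r x -> `|'D_v f x| <= c * `|v|) ->
  forall x y, ball x0 r x -> ball x0 r y -> `|f x - f y| <= c * `|x - y|.
Proof.
move=> c0 df Df x y bx by_; apply: mx_norm_le => [|i j]; first exact: mulr_ge0.
rewrite (ord1 i) !mxE.
have seg := ball_segment by_ bx.
have [|t t01 ->] := @mean_value _ (fun z => f z 0 j) y x; last first.
  rewrite (derive_coord _ _ _ (df _ (seg t t01))).
  by apply: le_trans (mx_norm_coord _ _ _) _; apply: Df; exact: seg.
move=> t t01; apply: (differentiable_comp (g := fun z : 'rV[R]_n => z 0 j)).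
  exact: df (seg _ t01).
exact: differentiable_coord.
Qed.

Lemma Ck_on_id {V : normedModType R} k (U : set V) : Ck_on k U id.
Proof.
case: k => [|k] /=; first by move=> x _; exact: cvg_id.
split=> [x _|v]; first exact: ex_diff.
rewrite (_ : (fun x => _) = cst v); first exact: Ck_on_cst.
by apply/funext => x; rewrite derive_id.
Qed.

Lemma smooth_mulmxr n p (U : set 'rV[R]_n) (A : 'M[R]_(n, p)) : open U ->
  smooth_on U (fun x => x *m A).
Proof.
move=> oU k; apply/Ck_on_rowP => // j.
have CS : Ck_on k U (fun x => \sum_i x 0 i * A i j).
  apply: Ck_on_sum => // i _; apply: Ck_onM => //; last exact: Ck_on_cst.
  exact: (Ck_on_rowP k id oU).1 (Ck_on_id k U) i.
by apply: (eq_Ck_on oU _ CS) => x _; rewrite mxE.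
Qed.

Lemma mulmxr_lipschitz n p (A : 'M[R]_(n, p)) :
  continuous (mulmxr A : 'rV[R]_n -> 'rV[R]_p) /\
  exists2 c : R, 0 < c & forall v : 'rV[R]_n, `|v *m A| <= c * `|v|.
Proof.
have cA : continuous (mulmxr A : 'rV[R]_n -> 'rV[R]_p).
  by move=> x; exact: (@smooth_mulmxr n p setT A openT 0).
by split=> //; exact: linear_lipschitz cA.
Qed.

Lemma derive_mulmxr {V : normedModType R} n p (A : 'M[R]_(n, p))
    (f : V -> 'rV[R]_n) x v :
  differentiable f x ->
  differentiable (fun y => f y *m A) x /\
  'D_v (fun y => f y *m A) x = 'D_v f x *m A.
Proof.
move=> df; have [cA _] := mulmxr_lipschitz A.
have dA y : differentiable (mulmxr A : 'rV[R]_n -> 'rV[R]_p) y.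
  exact: linear_differentiable.
split; first exact: (differentiable_comp df (dA _)).
rewrite (derive_comp v df (dA (f x))) (deriveE _ (dA _)).
by rewrite (@diff_lin _ _ _ (mulmxr A : {linear 'rV[R]_n -> 'rV[R]_p})).
Qed.

(** Continuity of the partial derivatives makes the differential uniformly
    small near [x0], and the mean value theorem applies on a convex ball. *)
Lemma small_derivative_lipschitz n p (U : set 'rV[R]_n)
    (f : 'rV[R]_n -> 'rV[R]_p) x0 (c : R) :
  open U -> U x0 -> Ck_on 1 U f -> (forall v, 'D_v f x0 = 0) -> 0 < c ->
  exists r : R, [/\ 0 < r, ball x0 r `<=` U,
    (forall x v, ball x0 r x -> `|'D_v f x| <= c * `|v|) &
    (forall x y, ball x0 r x -> ball x0 r y -> `|f x - f y| <= c * `|x - y|)].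
Proof.
move=> oU Ux0 [df Df] D0 c0.
have e0 : 0 < c / n.+1%:R by rewrite divr_gt0.
have : \forall x \near x0, U x /\
    forall i : 'I_n, `|'D_(delta_mx 0 i) f x| <= c / n.+1%:R.
  apply: filterI; first exact: open_nbhs_nbhs.
  have nF : Filter (nbhs x0) by exact: nbhs_filter.
  apply: (@filter_forall _ _ _ _ nF) => i.
  have /cvgrPdist_le/(_ _ e0) := Df (delta_mx 0 i) x0 Ux0.
  by apply: filterS => x; rewrite D0 sub0r normrN.
move=> /nbhs_ballP[r /= r0 H]; exists r.
have Dle x v : ball x0 r x -> `|'D_v f x| <= c * `|v|.
  move=> /H[Ux Dx]; rewrite (derive_row_sum _ (df _ Ux)).
  apply: le_trans (ler_norm_sum _ _ _) _.
  apply: (@le_trans _ _ (\sum_(i < n) c / n.+1%:R * `|v|)).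
    apply: ler_sum => i _; rewrite normrZ mulrC ler_pM//.
    exact: mx_norm_coord.
  rewrite sumr_const card_ord -[_ *+ n]mulr_natr mulrAC ler_wpM2r//.
  rewrite -mulrA ler_piMr//; first exact: ltW.
  by rewrite mulrC ler_pdivrMr// mul1r ler_nat.
split=> //; first by move=> x /H[].
apply: mean_value_le => //; first exact: ltW.
by move=> x /H[Ux _]; exact: df.
Qed.

(** The point of the closed ball that minimizes the distance from [x + h x] to
    [z] attains [z]: otherwise the step from [x] to [z - h x], which is
    the contraction of Banach's argument, halves that distance. *)
Lemma perturbation_open n (h : 'rV[R]_n -> 'rV[R]_n) (x0 : 'rV[R]_n) (r : R) :
  (forall x y : 'rV[R]_n, ball x0 r x -> ball x0 r y ->
     `|h x - h y| <= 2^-1 * `|x - y|) ->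
  open [set z : 'rV[R]_n | exists2 x : 'rV[R]_n, ball x0 r x & x + h x = z].
Proof.
move=> lip; rewrite openE => _ [x bx <-]; rewrite /interior.
have /nbhs_ballP[s0 /= s00 Bs0] : nbhs x (ball x0 r).
  by apply: open_nbhs_nbhs; split=> //; exact: ball_open.
pose s := s0 / 2; have s_gt0 : 0 < s by rewrite divr_gt0.
pose K := [set y : 'rV[R]_n | `|x - y| <= s].
have KE : K = closed_ball x s by rewrite closed_ballE.
have KB y : K y -> ball x0 r y.
  move=> Ky; apply: Bs0; rewrite -ball_normE /=.
  by apply: le_lt_trans Ky _; rewrite /s ltr_pdivrMr// ltr_pMr// ltr1n.
have Kx : K x by rewrite /K /= subrr normr0 ltW.
have Kcompact : compact K.
  apply: bounded_closed_compact; last by rewrite KE; exact: closed_ball_closed.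
  exists (`|x| + s); split; first exact: num_real.
  move=> M ltM y Ky; apply: le_trans (ltW ltM).
  rewrite -[y](subKr x); apply: le_trans (ler_normB _ _) _.
  by rewrite lerD2l.
apply/nbhs_ballP; exists (s / 2); first by rewrite /= divr_gt0.
move=> z xz; have {xz} : `|x + h x - z| <= s / 2.
  by move: xz; rewrite -ball_normE /= => /ltW.
move=> xz.
have ch (y : 'rV[R]_n) : ball x0 r y -> {for y, continuous h}.
  move=> by_; apply/(@cvgrPdist_le _ _ _ (nbhs y)) => e e0.
  have ny : \forall t \near y, ball x0 r t /\ `|y - t| <= e.
    apply: filterI; last first.
      by apply/nbhs_ballP; exists e => // t; rewrite -ball_normE /= => /ltW.
    by apply: open_nbhs_nbhs; split=> //; exact: ball_open.
  apply: filterS ny => t [bt yt]; apply: le_trans (lip _ _ by_ bt) _.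
  by rewrite -[leRHS]mul1r ler_pM// invf_le1// ler1n.
have [||c] := @EVT_min_rV _ _ (fun y : 'rV[R]_n => `|z - (y + h y)|) K _
  Kcompact.
- by exists x.
- apply: continuous_in_subspaceT => y; rewrite inE => /KB/ch chy.
  have c1 : {for y, continuous (fun y : 'rV[R]_n => y + h y)}.
    by apply: (@continuousD _ _ _ id h) => //; exact: cvg_id.
  have c2 : {for y, continuous (fun y : 'rV[R]_n => z - (y + h y))}.
    by apply: (@continuousB _ _ _ (cst z)) => //; exact: cst_continuous.
  by apply: (continuous_comp c2); exact: norm_continuous.
rewrite inE => Kc cmin.
have bc : ball x0 r c by exact: KB.
exists c => //.
(* One step of the fixed point iteration for [x = z - h x]. *)
pose c' := z - h c.
have Kc' : K c'.
  rewrite /K /= /c'.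
  have -> : x - (z - h c) = (x + h x - z) + (h c - h x).
    by apply/rowP => j; rewrite !mxE; ring.
  apply: le_trans (ler_normD _ _) _; rewrite [leRHS]splitr lerD//.
  apply: le_trans (lip _ _ (KB _ Kc) bx) _.
  by rewrite mulrC distrC ler_wpM2r// invr_ge0.
have /= := cmin c'; rewrite inE => /(_ Kc').
have -> : z - (c' + h c') = h c - h c'.
  by apply/rowP => j; rewrite !mxE; ring.
move=> /le_trans/(_ (lip _ _ (KB _ Kc) (KB _ Kc'))).
have -> : c - c' = - (z - (c + h c)) by apply/rowP => j; rewrite !mxE; ring.
rewrite normrN -{1}[`|_|]mul1r -subr_le0 -mulrBl.
rewrite pmulr_rle0 ?subr_gt0 ?invf_lt1 ?ltr1n//.
by rewrite normr_le0 subr_eq0 => /eqP ->.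
Qed.

End InverseFunction.

Section InverseFunctionTheorem.
Context {R : realType} {N : nat}.
Implicit Types (U : set 'rV[R]_N) (G : 'rV[R]_N -> 'rV[R]_N).

Lemma unitmx_inj (B : 'M[R]_N) :
  (forall v : 'rV[R]_N, v *m B = 0 -> v = 0) -> B \in unitmx.
Proof. by move=> H; rewrite -row_free_unit; exact: inj_row_free. Qed.

Lemma Ck_on_jacobian k U G i j : open U -> Ck_on k.+1 U G ->
  Ck_on k U (fun x => jacobian G x i j).
Proof.
move=> oU [dG DG].
apply: (eq_Ck_on oU _ ((Ck_on_rowP k _ oU).1 (DG (delta_mx 0 i)) j)) => x Ux.
by rewrite (deriveEjacobian _ (dG x Ux)) -rowE mxE.
Qed.

(** Near a point with invertible Jacobian, [G] is bi-Lipschitz and open: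
    followed by the inverse of that Jacobian it is a perturbation of the
    identity by a map with small derivative. *)
Lemma local_inverse U G (x0 : 'rV[R]_N) : open U -> U x0 -> Ck_on 1 U G ->
  jacobian G x0 \in unitmx ->
  exists (r c : R), [/\ 0 < r /\ 0 < c, ball x0 r `<=` U,
    (forall x, ball x0 r x -> jacobian G x \in unitmx),
    (forall x y, ball x0 r x -> ball x0 r y ->
      `|x - y| <= c * `|G x - G y|) &
    open (G @` ball x0 r)].
Proof.
move=> oU Ux0 CG uJ.
set J := jacobian G x0; set A := invmx J.
have [dG DG] := CG.
pose h : 'rV[R]_N -> 'rV[R]_N := fun x => G x *m A - x.
have Ch : Ck_on 1 U h.
  have C1 := Ck_on_comp oU openT (fun _ _ => I) CG (smooth_mulmxr A openT 1).
  have C2 : Ck_on 1 U (fun x : 'rV[R]_N => x *m - (1%:M : 'M[R]_N)).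
    exact: smooth_mulmxr.
  apply: (eq_Ck_on oU _ (Ck_onD oU C1 C2)) => x _.
  by rewrite /h !fctE /= mulmxN mulmx1.
have Dh x v : U x -> 'D_v h x = v *m (jacobian G x *m A) - v.
  move=> Ux; have [dGA DGA] := derive_mulmxr A v (dG x Ux).
  rewrite /h (@deriveB _ _ _ (fun x => G x *m A) id).
  - by rewrite DGA derive_id (deriveEjacobian _ (dG x Ux)) mulmxA.
  - exact: diff_derivable.
  - exact: derivable_id.
have h2 : (0 : R) < 2^-1 by rewrite invr_gt0.
have Dh0 v : 'D_v h x0 = 0 by rewrite Dh// mulmxV// mulmx1 subrr.
have [r [r0 rU Dle lip]] := small_derivative_lipschitz oU Ux0 Ch Dh0 h2.
have [_ [c c0 cA]] := mulmxr_lipschitz A.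
exists r, (2 * c); split.
- by split; rewrite ?mulr_gt0.
- exact: rU.
- move=> x bx; apply: unitmx_inj => v vJ.
  have := Dle x v bx; rewrite Dh; last exact: rU.
  rewrite mulmxA vJ mul0mx sub0r normrN => lev; apply/eqP.
  rewrite -normr_le0; have := normr_ge0 v; lra.
- move=> x y bx by_; have := lip x y bx by_.
  have := cA (G x - G y); rewrite mulmxBl => le1 le2.
  have -> : x - y = (G x *m A - G y *m A) - (h x - h y).
    by apply/rowP => j; rewrite /h !mxE; ring.
  have := ler_normB (G x *m A - G y *m A) (h x - h y).
  have : `|x - y| <= `|G x *m A - G y *m A| + `|h x - h y|.
    have {1}-> : x - y = (G x *m A - G y *m A) - (h x - h y).
      by apply/rowP => j; rewrite /h !mxE; ring.
    exact: ler_normB.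
  lra.
have oh := perturbation_open lip.
have [cJ _] := mulmxr_lipschitz A.
have -> : G @` ball x0 r = (mulmxr A : 'rV[R]_N -> 'rV[R]_N) @^-1`
    [set z : 'rV[R]_N | exists2 x : 'rV[R]_N, ball x0 r x & x + h x = z].
  apply/seteqP; split=> [_ [x bx <-]|y [x bx xy]] /=; exists x => //.
    by rewrite /h addrC subrK.
  move: xy; rewrite /h addrC subrK => /(congr1 (mulmx^~ J)).
  by rewrite -!mulmxA mulVmx// !mulmx1.
by apply: open_comp => // x _; exact: cJ.
Qed.

Definition local_inv G (B : set 'rV[R]_N) (y : 'rV[R]_N) : 'rV[R]_N :=
  xget 0 [set x | B x /\ G x = y].

(** Differentiating [G (H y) = y] gives the derivative of the inverse as the
    inverse of the Jacobian at [H y]; the adjugate formula makes this an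
    expression in [H] of the regularity already known for [H]. *)
Theorem inverse_function_theorem U G (x0 : 'rV[R]_N) :
  open U -> U x0 -> smooth_on U G -> jacobian G x0 \in unitmx ->
  exists (B : set 'rV[R]_N) (H : 'rV[R]_N -> 'rV[R]_N),
    [/\ open B /\ B x0, B `<=` U, open (G @` B),
        (forall x, B x -> H (G x) = x) & smooth_on (G @` B) H].
Proof.
move=> oU Ux0 sG uJ.
have [r [c [[r0 c0] rU uJx lip oV]]] := local_inverse oU Ux0 (sG 1%N) uJ.
set B := ball x0 r in rU uJx lip oV *.
have oB : open B by exact: ball_open.
pose H := local_inv G B.
have HG x : B x -> H (G x) = x.
  move=> Bx; rewrite /H /local_inv.
  have [Bx' Gx'] := xgetI 0
    (conj Bx (erefl (G x)) : [set z | B z /\ G z = G x] x).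
  apply/eqP; rewrite -subr_eq0 -normr_le0.
  by apply: le_trans (lip _ _ Bx' Bx) _; rewrite Gx' subrr normr0 mulr0.
have HB y : (G @` B) y -> B (H y) /\ G (H y) = y.
  by move=> [x Bx <-]; rewrite HG.
have dG x : B x -> differentiable G x.
  by move=> Bx; have [dG _] := sG 1%N; apply: dG; exact: rU.
have lipH y y' : (G @` B) y -> (G @` B) y' -> `|H y' - H y| <= c * `|y' - y|.
  move=> /HB[By Gy] /HB[By' Gy'].
  by have := lip _ _ By' By; rewrite Gy Gy'.
have dH y : (G @` B) y -> differentiable H y /\
    forall v, 'D_v H y = v *m invmx (jacobian G (H y)).
  move=> Vy; have [By Gy] := HB y Vy.
  set x := H y in By Gy *; set K := invmx (jacobian G x).
  have [cK [k k0 kK]] := mulmxr_lipschitz K.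
  have [|dHy DHy] := @differentiable_of_le_eps _ _ _ H y (mulmxr K) cK.
    move=> e e0.
    have e1 : 0 < e / (k * c) by rewrite divr_gt0// mulr_gt0.
    have := differentiable_le_eps (dG x By) e1.
    move=> /nbhs_normP[d /= d0 Hd].
    have d1 : 0 < d / c by rewrite divr_gt0.
    have nV : \forall y' \near y, (G @` B) y' /\ `|y - y'| < d / c.
      apply: filterI; first exact: open_nbhs_nbhs.
      by apply/nbhs_ballP; exists (d / c) => // z; rewrite -ball_normE.
    apply: filterS nV => y' [Vy' yy'].
    have [By' Gy'] := HB y' Vy'; set x' := H y' in By' Gy' *.
    have xx' : `|x' - x| <= c * `|y' - y| by exact: lipH.
    have /Hd : `|x - x'| < d.
      rewrite distrC; apply: le_lt_trans xx' _.
      by rewrite mulrC -ltr_pdivlMr// distrC.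
    rewrite -deriveE; last exact: dG.
    rewrite (deriveEjacobian _ (dG x By)) Gy Gy' => le1.
    have -> : H y' - H y - (mulmxr K) (y' - y) =
        - ((y' - y - (x' - x) *m jacobian G x) *m K).
      rewrite /= [in RHS]mulmxBl -[in RHS]mulmxA mulmxV; last exact: uJx.
      by rewrite mulmx1 opprB.
    rewrite normrN; apply: le_trans (kK _) _.
    apply: (@le_trans _ _ (k * (e / (k * c) * `|x' - x|))).
      by rewrite ler_wpM2l// ltW.
    apply: (@le_trans _ _ (k * (e / (k * c) * (c * `|y' - y|)))).
      by rewrite ler_wpM2l ?ler_wpM2l// ltW.
    rewrite le_eqVlt; apply/orP; left; apply/eqP.
    by field; rewrite !gt_eqF.
  by split=> // v; rewrite (deriveE _ dHy) DHy.
exists B, H; split=> //; first by split=> //; exact: ballxx.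
elim=> [|k IH].
  by move=> y /dH[dHy _]; exact: differentiable_continuous.
split=> [y /dH[]//|v].
apply/Ck_on_rowP => // j.
have CS : Ck_on k (G @` B)
    (fun y => \sum_i v 0 i * invmx (jacobian G (H y)) i j).
  apply: Ck_on_sum; first exact: oV.
  move=> i _; apply: (Ck_onM oV (Ck_on_cst k _ (v 0 i))).
  apply: Ck_on_invmx; [exact: oV|by move=> y /HB[] /uJx|].
  move=> i' j'; have CJ := Ck_on_jacobian i' j' oU (sG k.+1).
  apply: (Ck_on_comp_real oV _ IH CJ).
  by move=> y /HB[/rU].
by apply: (eq_Ck_on oV _ CS) => y /dH[_ ->]; rewrite mxE.
Qed.

End InverseFunctionTheorem.

(** * Multilinear and alternating forms *)

Section MultilinearForms.
Context {R : realType} {n k : nat}.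
Local Notation E := 'rV[R]_(n + n).
Implicit Types (a : ('I_k -> E) -> R) (v : 'I_k -> E).

Lemma dfwithE v l x j : dfwith v l x j = if j == l then x else v j.
Proof.
by case: eqVneq => [->|jl]; rewrite ?dfwithin// dfwithout// eq_sym.
Qed.

Lemma dfwith_id v l : dfwith v l (v l) = v.
Proof. by apply/funext => j; rewrite dfwithE; case: eqP => // ->. Qed.

Lemma dfwith_dfwith v l x y : dfwith (dfwith v l x) l y = dfwith v l y.
Proof. by apply/funext => j; rewrite !dfwithE; case: eqP. Qed.

Lemma dfwith_comm v l l' x y : l != l' ->
  dfwith (dfwith v l x) l' y = dfwith (dfwith v l' y) l x.
Proof.
move=> ll'; apply/funext => j; rewrite !dfwithE.
by case: (eqVneq j l') => [->|//]; rewrite eq_sym (negbTE ll').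
Qed.

Lemma multilinear0 a v l : multilinear a -> a (dfwith v l 0) = 0.
Proof.
by move=> /(_ v l (-1) 0 0); rewrite scaler0 addr0 mulN1r addNr.
Qed.

Lemma multilinearZ a v l c x : multilinear a ->
  a (dfwith v l (c *: x)) = c * a (dfwith v l x).
Proof. by move=> ml; rewrite -[c *: x]addr0 ml multilinear0// addr0. Qed.

Lemma multilinearD a v l x y : multilinear a ->
  a (dfwith v l (x + y)) = a (dfwith v l x) + a (dfwith v l y).
Proof. by move=> ml; rewrite -[x]scale1r ml mul1r scale1r. Qed.

Lemma multilinear_sum a v l (I : finType) (c : I -> R) (x : I -> E) :
  multilinear a ->
  a (dfwith v l (\sum_i c i *: x i)) = \sum_i c i * a (dfwith v l (x i)).
Proof.
move=> ml; elim/big_rec2: _ => [|i y1 y2 _ <-]; first exact: multilinear0.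
exact: ml.
Qed.

(** The slots are filled one after the other; [Z] is abstract so that the same
    induction serves real spans and complex ones. *)
Lemma span_induction (I : Type) (e : I -> E) (sp : E -> Prop)
    (Z : ('I_k -> E) -> Prop) :
  (forall v l x, sp x -> (forall i, Z (dfwith v l (e i))) ->
     Z (dfwith v l x)) ->
  (forall f : 'I_k -> I, Z (e \o f)) ->
  forall v, (forall l, sp (v l)) -> Z v.
Proof.
move=> closed Ze.
have H : forall j, (j <= k)%N -> forall v,
    (forall l : 'I_k, (l < j)%N -> sp (v l)) ->
    (forall l : 'I_k, (j <= l)%N -> exists i, v l = e i) -> Z v.
  elim=> [_ v _ ev|j IH jk v spv ev].
    have /choice[f fE] : forall l, exists i, v l = e i by move=> l; exact: ev.
    by have := Ze f; congr Z; apply/funext => l; rewrite /= fE.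
  pose l0 := Ordinal jk.
  rewrite -(dfwith_id v l0); apply: closed; first exact: spv.
  move=> i; apply: IH; first exact: ltnW.
    move=> l lj; rewrite dfwithE ifF; first by apply: spv; exact: ltnW.
    by apply/negbTE; rewrite neq_ltn lj.
  move=> l; rewrite leq_eqVlt dfwithE => /orP[/eqP jl|jl].
    by exists i; rewrite ifT//; apply/eqP/val_inj.
  rewrite ifF; first exact: ev.
  by apply/negbTE; rewrite neq_ltn jl orbT.
move=> v spv; apply: (H k) => // l.
by rewrite leqNgt ltn_ord.
Qed.

Lemma multilinear_span (I : finType) (e : I -> E) a v :
  multilinear a -> (forall f : 'I_k -> I, a (e \o f) = 0) ->
  (forall l, exists c : I -> R, v l = \sum_i c i *: e i) -> a v = 0.
Proof.
move=> ml ae; move: v.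
apply: (span_induction (e := e)
  (sp := fun x => exists c : I -> R, x = \sum_i c i *: e i)
  (Z := fun v => a v = 0)) => //.
move=> v l _ [c ->] H; rewrite multilinear_sum// big1// => i _.
by rewrite H mulr0.
Qed.

Lemma alternating_tperm a v l l' : multilinear a -> Defs.alternating a ->
  l != l' -> a (v \o tperm l l') = - a v.
Proof.
move=> ml alt ll'.
pose w x y := dfwith (dfwith v l x) l' y.
have wl x y : w x y = dfwith (dfwith v l' y) l x by rewrite /w dfwith_comm.
have wD x x' y : a (w (x + x') y) = a (w x y) + a (w x' y).
  by rewrite !wl multilinearD.
have wD' x y y' : a (w x (y + y')) = a (w x y) + a (w x y').
  by rewrite /w multilinearD.
have w0 x : a (w x x) = 0.
  apply: (alt _ l l') => //; rewrite /w !dfwithE eqxx.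
  by rewrite (negbTE ll') eqxx.
have := w0 (v l + v l'); rewrite wD !wD' !w0 add0r addr0.
have -> : w (v l) (v l') = v by rewrite /w !dfwith_id.
have -> : w (v l') (v l) = v \o tperm l l'.
  apply/funext => j; rewrite /w !dfwithE /=.
  case: tpermP => [->|->|/eqP/negbTE-> /eqP/negbTE->] //.
    by rewrite (negbTE ll') eqxx.
  by rewrite eqxx.
by move=> /eqP; rewrite addrC addr_eq0 => /eqP.
Qed.

(** A non-injective [f] repeats an argument; an injective one is a product of
    transpositions, each of which changes the sign. *)
Lemma alternating_reindex a (e : 'I_k -> E) (f : 'I_k -> 'I_k) :
  multilinear a -> Defs.alternating a -> a e = 0 -> a (e \o f) = 0.
Proof.
move=> ml alt; have [injf|ninjf] := pselect (injective f); last first.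
  move=> _; have [l [l' [ll' fE]]] : exists l l', l != l' /\ f l = f l'.
    apply: contrapT => H; apply: ninjf => l l' fE; apply: contrapT => /eqP ll'.
    by apply: H; exists l, l'.
  by apply: (alt _ l l') => //=; rewrite fE.
have -> : e \o f = e \o perm injf by apply/funext => l; rewrite /= permE.
have [ts -> _] := prod_tpermP (perm injf).
elim: ts e => [|t ts IH] e ae.
  by rewrite big_nil -[RHS]ae; congr a; apply/funext => l; rewrite /= perm1.
rewrite big_cons.
have [tE|tN] := eqVneq t.1 t.2.
  by rewrite tE tperm1 mul1g; exact: IH.
have -> : e \o (tperm t.1 t.2 * \prod_(t <- ts) tperm t.1 t.2)%g =
    (e \o (\prod_(t <- ts) tperm t.1 t.2)%g) \o tperm t.1 t.2.
  by apply/funext => l; rewrite /= permM.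
by rewrite alternating_tperm// IH// oppr0.
Qed.

Lemma alternating_dependent a v l : multilinear a -> Defs.alternating a ->
  (exists2 c : 'I_k -> R, c l != 0 & \sum_j c j *: v j = 0) -> a v = 0.
Proof.
move=> ml alt [c cl]; rewrite (bigD1 l)//= => /eqP.
rewrite addr_eq0 => /eqP cE.
have : c l * a (dfwith v l (v l)) = 0.
  rewrite -multilinearZ// cE -[- _]scaleN1r multilinearZ//.
  rewrite (_ : \sum_(_ | _) _ = \sum_j (if j != l then c j else 0) *: v j).
    rewrite multilinear_sum// big1 ?mulr0// => j _.
    case: eqVneq => [_|jl]; first by rewrite mul0r.
    rewrite (alt _ l j) ?mulr0//; first by rewrite eq_sym.
    by rewrite !dfwithE eqxx (negbTE jl).
  rewrite big_mkcond; apply: eq_bigr => j _.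
  by case: ifP => // _; rewrite scale0r.
by move/eqP; rewrite mulf_eq0 (negbTE cl) dfwith_id => /eqP.
Qed.

End MultilinearForms.

(** * Linear algebra of the orbit directions *)

Section ComplexStructure.
Context {R : realType} {n : nat}.
Local Notation E := 'rV[R]_(n + n).

Lemma mulI_is_linear : linear (@mulI R n).
Proof.
move=> c u v; apply/rowP => j; rewrite /mulI !mxE.
by case: (fintype.split j) => i; rewrite !mxE//; ring.
Qed.

HB.instance Definition _ :=
  GRing.isLinear.Build R E E _ (@mulI R n) mulI_is_linear.

Lemma mulID (u v : E) : mulI (u + v) = mulI u + mulI v.
Proof. exact: linearD. Qed.

Lemma mulIZ (c : R) (u : E) : mulI (c *: u) = c *: mulI u.
Proof. exact: linearZ. Qed.

Lemma mulIK (v : E) : mulI (mulI v) = - v.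
Proof.
by rewrite /mulI row_mxKl row_mxKr -opp_row_mx hsubmxK.
Qed.

End ComplexStructure.

Section RegularPoint.
Context {R : realType} {m : nat}.
Local Notation n := m.+1.
Local Notation E := 'rV[R]_(n + n).
Context (o : ('I_2 -> E) -> R) (Phi : ('I_n -> E) -> R[i]) (X : 'I_m -> E).
Local Notation pair u w := (tnth [tuple u; w]).
Local Notation om u w := (o (pair u w)).

Context (o_ml : multilinear o) (o_alt : Defs.alternating o).
Hypothesis o_pos : forall v : E, v != 0 -> 0 < om v (mulI v).
Hypothesis Re_ml : multilinear (fun v => complex.Re (Phi v)).
Hypothesis Re_alt : Defs.alternating (fun v => complex.Re (Phi v)).
Hypothesis Im_ml : multilinear (fun v => complex.Im (Phi v)).
Hypothesis Im_alt : Defs.alternating (fun v => complex.Im (Phi v)).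
Hypothesis Phi_J : forall v l, Phi (dfwith v l (mulI (v l))) = 'i%C * Phi v.
Hypothesis Phi_neq0 : exists v, Phi v != 0.
Hypothesis X_free : forall c, \sum_j c j *: X j = 0 -> forall j, c j = 0.
Hypothesis X_iso : forall i j, om (X i) (X j) = 0.

Lemma om_linl u v c w : om (c *: u + v) w = c * om u w + om v w.
Proof.
have H x : pair x w = dfwith (pair u w) (ord0 : 'I_2) x.
  by apply/funext => j; rewrite dfwithE; case: j => [[|[|]]].
by rewrite H o_ml -!H.
Qed.

Lemma om_linr u v c w : om w (c *: u + v) = c * om w u + om w v.
Proof.
have H x : pair w x = dfwith (pair w u) (ord_max : 'I_2) x.
  by apply/funext => j; rewrite dfwithE; case: j => [[|[|]]].
by rewrite H o_ml -!H.
Qed.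

Lemma om_diag u : om u u = 0.
Proof. by apply: (o_alt (l := ord0) (l' := ord_max)). Qed.

Lemma om_suml (I : finType) (c : I -> R) (x : I -> E) w :
  om (\sum_i c i *: x i) w = \sum_i c i * om (x i) w.
Proof.
elim/big_rec2: _ => [|i y1 y2 _ <-]; last exact: om_linl.
by have := om_linl 0 0 (-1) w; rewrite scaler0 addr0 mulN1r addNr.
Qed.

Lemma om_sumr (I : finType) (c : I -> R) (x : I -> E) w :
  om w (\sum_i c i *: x i) = \sum_i c i * om w (x i).
Proof.
elim/big_rec2: _ => [|i y1 y2 _ <-]; last exact: om_linr.
by have := om_linr 0 0 (-1) w; rewrite scaler0 addr0 mulN1r addNr.
Qed.

(** [om u (mulI u)] is the squared length of [u] for the Kaehler metric. *)
Lemma om_pos0 u : om u (mulI u) = 0 -> u = 0.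
Proof.
move=> u0; apply/eqP; apply: contraT => /o_pos.
by rewrite u0 ltxx.
Qed.

Lemma om_nondegenerate (c : R) (z u v : E) :
  (forall w, om z w = c * om u w + om v w) -> z = c *: u + v.
Proof.
move=> zE; apply/eqP; rewrite eq_sym -subr_eq0; apply/eqP; apply: om_pos0.
have -> : c *: u + v - z = (-1) *: z + (c *: u + v).
  by rewrite scaleN1r addrC.
by rewrite !om_linl zE mulN1r addNr.
Qed.

Lemma om_antisym u v : om u v = - om v u.
Proof.
have Dl w : om (u + v) w = om u w + om v w.
  by have := om_linl u v 1 w; rewrite scale1r mul1r.
have Dr w : om w (u + v) = om w u + om w v.
  by have := om_linr u v 1 w; rewrite scale1r mul1r.
have := om_diag (u + v); rewrite Dl !Dr !om_diag add0r addr0.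
by move/eqP; rewrite addr_eq0 => /eqP.
Qed.

Lemma om_comb_iso (a b : 'I_m -> R) :
  om (\sum_j a j *: X j) (\sum_j b j *: X j) = 0.
Proof.
rewrite om_suml big1// => i _; rewrite om_sumr big1 ?mulr0// => j _.
by rewrite X_iso mulr0.
Qed.

(** An isotropic family that is independent over the reals stays independent
    over the complex numbers: a real subspace on which [o] vanishes meets
    its image under [mulI] trivially. *)
Lemma isotropic_totally_real (a b : 'I_m -> R) :
  \sum_j a j *: X j + mulI (\sum_j b j *: X j) = 0 ->
  (forall j, a j = 0) /\ (forall j, b j = 0).
Proof.
set x := \sum_j a j *: X j; set y := \sum_j b j *: X j => xy.
have y0 : y = 0.
  apply: om_pos0; rewrite (_ : mulI y = -1 *: x + 0); last first.
    by rewrite addr0 scaleN1r; apply/eqP; rewrite -addr_eq0 addrC xy.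
  have yx : om y x = 0 by exact: om_comb_iso.
  have := om_linr 0 0 (-1) y; rewrite scaler0 addr0 mulN1r addNr => y00.
  by rewrite om_linr yx mulr0 y00 addr0.
have x0 : x = 0 by move: xy; rewrite y0 linear0 addr0.
by split; apply: X_free.
Qed.

(** Written with [unlift] so that [contracted_form] is, by conversion, [phi]
    evaluated on a frame. *)
Definition frame (Y : 'I_m -> E) (w : E) : 'I_n -> E :=
  fun k => if unlift ord_max k is Some j then Y j else w.

Lemma frame_lift Y w j : frame Y w (lift ord_max j) = Y j.
Proof. by rewrite /frame liftK. Qed.

Lemma frame_max Y w : frame Y w ord_max = w.
Proof. by rewrite /frame unlift_none. Qed.

Lemma sum_frame (V : nmodType) (F : 'I_n -> V) :
  \sum_k F k = \sum_j F (lift ord_max j) + F ord_max.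
Proof.
rewrite big_ord_recr /=; congr (_ + _); apply: eq_bigr => j _; congr F.
by apply: val_inj; rewrite /= /bump leqNgt ltn_ord.
Qed.

Lemma frame_dfwith Y w x : frame Y x = dfwith (frame Y w) ord_max x.
Proof.
apply/funext => k; rewrite dfwithE /frame.
by case: unliftP => [j ->|->]; rewrite ?eqxx// eq_sym (negbTE (neq_lift _ _)).
Qed.

Local Notation alpha w := (Phi (frame X w)).

Lemma Re_alpha_lin c u v :
  complex.Re (alpha (c *: u + v)) =
  c * complex.Re (alpha u) + complex.Re (alpha v).
Proof.
rewrite (frame_dfwith X 0 u) (frame_dfwith X 0 v) (frame_dfwith X 0 (_ + _)).
exact: Re_ml.
Qed.

Lemma Im_alpha_lin c u v :
  complex.Im (alpha (c *: u + v)) =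
  c * complex.Im (alpha u) + complex.Im (alpha v).
Proof.
rewrite (frame_dfwith X 0 u) (frame_dfwith X 0 v) (frame_dfwith X 0 (_ + _)).
exact: Im_ml.
Qed.

Lemma alphaJ w : alpha (mulI w) = 'i%C * alpha w.
Proof.
by rewrite (frame_dfwith X w) -[in mulI _](frame_max X w) Phi_J.
Qed.

Lemma Re_alphaJ w : complex.Re (alpha (mulI w)) = - complex.Im (alpha w).
Proof. by rewrite alphaJ mulrC ReiNIm. Qed.

Lemma Im_alphaJ w : complex.Im (alpha (mulI w)) = complex.Re (alpha w).
Proof. by rewrite alphaJ mulrC ImiRe. Qed.

Lemma alpha_X j : alpha (X j) = 0.
Proof.
apply/eqP; rewrite eq_complex; apply/andP; split; apply/eqP.
  apply: (Re_alt (l := lift ord_max j) (l' := ord_max)).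
    by rewrite eq_sym neq_lift.
  by rewrite frame_lift frame_max.
apply: (Im_alt (l := lift ord_max j) (l' := ord_max)).
  by rewrite eq_sym neq_lift.
by rewrite frame_lift frame_max.
Qed.

Definition complex_span_mx : 'M[R]_(m + m, n + n) :=
  col_mx (\matrix_j X j) (\matrix_j mulI (X j)).

Definition in_complex_span (u : E) := exists a b : 'I_m -> R,
  u = \sum_j a j *: X j + mulI (\sum_j b j *: X j).

Lemma in_spanP u : (u <= complex_span_mx)%MS -> in_complex_span u.
Proof.
move=> /submxP[D ->]; exists (fun j => lsubmx D 0 j), (fun j => rsubmx D 0 j).
rewrite -[D in LHS]hsubmxK mul_row_col !mulmx_sum_row.
congr (_ + _); last rewrite linear_sum /=.
  by apply: eq_bigr => j _; rewrite rowK.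
by apply: eq_bigr => j _; rewrite rowK linearZ.
Qed.

Lemma in_span_submx u : in_complex_span u -> (u <= complex_span_mx)%MS.
Proof.
move=> [a [b ->]]; apply/submxP; exists (row_mx (\row_j a j) (\row_j b j)).
rewrite mul_row_col !mulmx_sum_row; congr (_ + _).
  by apply: eq_bigr => j _; rewrite rowK mxE.
by rewrite linear_sum; apply: eq_bigr => j _; rewrite linearZ rowK mxE.
Qed.

Lemma in_span_lin c u v :
  in_complex_span u -> in_complex_span v -> in_complex_span (c *: u + v).
Proof.
move=> /in_span_submx su /in_span_submx sv; apply: in_spanP.
by rewrite addmx_sub// scalemx_sub.
Qed.

Lemma in_spanZ c u : c != 0 -> in_complex_span (c *: u) -> in_complex_span u.
Proof.
move=> c0 /in_span_submx su; apply: in_spanP.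
by rewrite -[u](scalerK c0) scalemx_sub.
Qed.

Lemma in_spanJ u : in_complex_span u -> in_complex_span (mulI u).
Proof.
move=> [a [b ->]]; exists (fun j => - b j), a.
rewrite mulID mulIK addrC; congr (_ + _).
by rewrite -sumrN; apply: eq_bigr => j _; rewrite scaleNr.
Qed.

Lemma exists_not_in_span : exists w, ~ in_complex_span w.
Proof.
suff [w ws] : exists w : E, ~ (w <= complex_span_mx)%MS.
  by exists w => /in_span_submx.
have : ~~ ((1%:M : 'M[R]_(n + n)) <= complex_span_mx)%MS.
  apply/negP => /mxrankS; rewrite mxrank1 => /leq_trans/(_ (rank_leq_row _)).
  by rewrite addSn addnS ltnNge leqnSn.
by move=> /row_subPn[i /negP H]; exists (row i 1%:M).
Qed.

(** A vector outside the complex span of [X], which is preserved by [mulI] and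
    has complex codimension one, completes [X] to a complex basis. *)
Lemma frame_spans w : ~ in_complex_span w -> forall z, exists a b : 'I_n -> R,
  z = \sum_k a k *: frame X w k + mulI (\sum_k b k *: frame X w k).
Proof.
move=> nw; pose Z : 'M[R]_(n + n) :=
  col_mx (\matrix_k frame X w k) (\matrix_k mulI (frame X w k)).
have mulZ D : D *m Z = \sum_k lsubmx D 0 k *: frame X w k +
    mulI (\sum_k rsubmx D 0 k *: frame X w k).
  rewrite -[D in LHS]hsubmxK mul_row_col !mulmx_sum_row; congr (_ + _).
    by apply: eq_bigr => j _; rewrite rowK.
  by rewrite linear_sum; apply: eq_bigr => j _; rewrite linearZ rowK.
have uZ : Z \in unitmx.
  apply: unitmx_inj => D; rewrite mulZ.
  rewrite !sum_frame frame_max; under eq_bigr do rewrite frame_lift.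
  under [X in mulI (X + _)]eq_bigr do rewrite frame_lift.
  set x := \sum_j _; set y := \sum_j _.
  set a := lsubmx D 0 ord_max; set b := rsubmx D 0 ord_max.
  rewrite mulID mulIZ => H.
  have sxy : in_complex_span (x + mulI y) by do 2 eexists; reflexivity.
  have zE : a *: w + b *: mulI w = (-1) *: (x + mulI y) + 0.
    rewrite addr0 scaleN1r; apply/eqP; rewrite -addr_eq0 -H; apply/eqP.
    by rewrite addrC addrACA.
  have s0 : in_complex_span 0 by apply: in_spanP; exact: sub0mx.
  have sz : in_complex_span (a *: w + b *: mulI w).
    by rewrite zE; exact: in_span_lin.
  have ab0 : a ^+ 2 + b ^+ 2 = 0.
    apply/eqP; apply: contraT => ab; case: nw; apply: (in_spanZ ab).
    have -> : (a ^+ 2 + b ^+ 2) *: w = a *: (a *: w + b *: mulI w) +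
        ((- b) *: mulI (a *: w + b *: mulI w) + 0).
      rewrite mulID !mulIZ mulIK.
      by apply/rowP => j; rewrite !mxE; ring.
    by apply: in_span_lin => //; apply: in_span_lin => //; exact: in_spanJ.
  have [a0 b0] : a = 0 /\ b = 0.
    move/eqP: ab0; rewrite paddr_eq0 ?sqr_ge0// !sqrf_eq0.
    by move=> /andP[/eqP ? /eqP ?].
  move: H; rewrite a0 b0 !scale0r !addr0 => /isotropic_totally_real[La Lb].
  have DE k : lsubmx D 0 k = 0 /\ rsubmx D 0 k = 0.
    by case: (unliftP ord_max k) => [j ->|->].
  rewrite -[D]hsubmxK; apply/rowP => k; rewrite !mxE.
  by case: (fintype.split k) => i; have [] := DE i; rewrite !mxE.
move=> z; exists (fun k => lsubmx (z *m invmx Z) 0 k).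
exists (fun k => rsubmx (z *m invmx Z) 0 k).
by rewrite -mulZ mulmxKV.
Qed.

Lemma Phi_eq0 v : Phi v = 0 <->
  complex.Re (Phi v) = 0 /\ complex.Im (Phi v) = 0.
Proof.
split=> [->//|[r i]].
by apply/eqP; rewrite eq_complex r i !eqxx.
Qed.

(** If [Phi] vanished on a complex basis it would vanish identically. *)
Lemma alpha_complement w : ~ in_complex_span w -> alpha w != 0.
Proof.
move=> nw; apply/negP => /eqP /Phi_eq0[re0 im0].
have [v /eqP] := Phi_neq0; apply.
apply: (span_induction (e := frame X w)
  (sp := fun z => exists a b : 'I_n -> R,
    z = \sum_k a k *: frame X w k + mulI (\sum_k b k *: frame X w k))
  (Z := fun v => Phi v = 0)) => [{}v l _ [a [b ->]] H|f|l].
- have S (c : 'I_n -> R) : Phi (dfwith v l (\sum_k c k *: frame X w k)) = 0.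
    apply/Phi_eq0; rewrite (multilinear_sum _ _ _ _ Re_ml).
    rewrite (multilinear_sum _ _ _ _ Im_ml).
    by split; apply: big1 => k _; have /Phi_eq0[r i] := H k;
      rewrite ?r ?i mulr0.
  have SJ (c : 'I_n -> R) :
      Phi (dfwith v l (mulI (\sum_k c k *: frame X w k))) = 0.
    set x := \sum_k _; have := Phi_J (dfwith v l x) l.
    by rewrite dfwithin dfwith_dfwith => ->; rewrite S mulr0.
  have /Phi_eq0[r1 i1] := S a; have /Phi_eq0[r2 i2] := SJ b.
  apply/Phi_eq0; rewrite (multilinearD _ _ _ _ Re_ml).
  by rewrite (multilinearD _ _ _ _ Im_ml) r1 r2 i1 i2 addr0.
- by apply/Phi_eq0; split; [exact: alternating_reindex Re_ml Re_alt re0|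
    exact: alternating_reindex Im_ml Im_alt im0].
- exact: frame_spans.
Qed.

Lemma alpha_span u : in_complex_span u -> alpha u = 0.
Proof.
have S (c : 'I_m -> R) : alpha (\sum_j c j *: X j) = 0.
  apply/Phi_eq0; rewrite (frame_dfwith X 0).
  rewrite (multilinear_sum _ _ _ _ Re_ml) (multilinear_sum _ _ _ _ Im_ml).
  by split; apply: big1 => j _; rewrite -frame_dfwith alpha_X mulr0.
move=> [a [b ->]]; apply/Phi_eq0.
rewrite -[X in X + mulI _]scale1r Re_alpha_lin Im_alpha_lin alphaJ !S.
by rewrite !mulr0 addr0.
Qed.

(** [alpha] vanishes on the complex span of [X] but not on a vector [w] that
    completes [X] to a complex basis, so the component of [z] along [w] is
    zero. *)
Lemma alpha_ker z : alpha z = 0 -> exists a b : 'I_m -> R,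
  z = \sum_j a j *: X j + mulI (\sum_j b j *: X j).
Proof.
have [w nw] := exists_not_in_span.
have [a [b ->]] := frame_spans nw z.
rewrite !sum_frame frame_max; under eq_bigr do rewrite frame_lift.
under [X in mulI (X + _)]eq_bigr do rewrite frame_lift.
set x := \sum_j _; set y := \sum_j _.
set c := a ord_max; set d := b ord_max.
have sxy : in_complex_span (x + mulI y) by do 2 eexists; reflexivity.
rewrite mulID mulIZ.
have -> : x + c *: w + (mulI y + d *: mulI w) =
    c *: w + (d *: mulI w + (x + mulI y)).
  by apply/rowP => j; rewrite !mxE; ring.
move=> /Phi_eq0; rewrite !Re_alpha_lin !Im_alpha_lin Re_alphaJ Im_alphaJ.
rewrite (alpha_span sxy) /= !addr0 => -[re0 im0].
have := alpha_complement nw; rewrite eq_complex negb_and /= => pq.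
set p := complex.Re (alpha w) in re0 im0 pq.
set q := complex.Im (alpha w) in re0 im0 pq.
have pq0 : p ^+ 2 + q ^+ 2 != 0.
  by rewrite paddr_eq0 ?sqr_ge0// !sqrf_eq0 negb_and.
have c0 : c = 0.
  apply: (mulIf pq0); rewrite mul0r.
  have -> : c * (p ^+ 2 + q ^+ 2) = p * (c * p + d * - q) + q * (c * q + d * p).
    by ring.
  by rewrite re0 im0 !mulr0 addr0.
have d0 : d = 0.
  apply: (mulIf pq0); rewrite mul0r.
  have -> : d * (p ^+ 2 + q ^+ 2) = p * (c * q + d * p) - q * (c * p + d * - q).
    by ring.
  by rewrite re0 im0 !mulr0 subr0.
by rewrite c0 d0 !scale0r !add0r.
Qed.

Lemma alpha_neq0 : exists w, alpha w != 0.
Proof. by have [w /alpha_complement nw] := exists_not_in_span; exists w. Qed.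

(** The gradients [mulI (X j)] of the components of the moment map are
    annihilated by [Im alpha], since [alpha] is complex linear and vanishes
    on [X]; they separate the first differentials from the last one. *)
Lemma differentials_free (c : 'I_m -> R) (d : R) :
  (forall w, \sum_j c j * om (X j) w + d * complex.Im (alpha w) = 0) ->
  (forall j, c j = 0) /\ d = 0.
Proof.
move=> H.
have c0 : forall j, c j = 0.
  pose x := \sum_j c j *: X j.
  have sx : in_complex_span x.
    exists c, (fun=> 0); rewrite [X in mulI X]big1 ?linear0 ?addr0// => j _.
    by rewrite scale0r.
  apply: X_free; apply: om_pos0; rewrite -/x {1}/x om_suml.
  by have := H (mulI x); rewrite Im_alphaJ (alpha_span sx) mulr0 addr0.
split=> //; have [w] := alpha_neq0; rewrite eq_complex negb_and.
have {}H u : d * complex.Im (alpha u) = 0.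
  by rewrite -[RHS](H u) big1 ?add0r// => j _; rewrite c0 mul0r.
move=> /orP[|] /= /negP nz; apply: contrapT => /eqP d0; apply: nz.
  rewrite -Im_alphaJ; have := H (mulI w) => /eqP.
  by rewrite mulf_eq0 (negbTE d0).
by have := H w => /eqP; rewrite mulf_eq0 (negbTE d0).
Qed.

(** With [om (X j)] and [Im alpha] the differentials of the components of
    [(mu, xi)], this is the kernel of the differential of that map. *)
Definition in_kernel z :=
  (forall j, om (X j) z = 0) /\ complex.Im (alpha z) = 0.

(** The imaginary part [mulI y] of an element of the complex span pairs with [X]
    as the metric pairs [y] with [X], so that orthogonality to [X] kills it. *)
Lemma alpha_ker_real z : (forall j, om (X j) z = 0) -> alpha z = 0 ->
  exists c : 'I_m -> R, z = \sum_j c j *: X j.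
Proof.
move=> Xz /alpha_ker[a [b zE]].
set x := \sum_j a j *: X j in zE; set y := \sum_j b j *: X j in zE.
have y0 : y = 0.
  apply: om_pos0.
  have -> : mulI y = (-1) *: x + z.
    by rewrite zE scaleN1r addrA addNr add0r.
  rewrite om_linr om_comb_iso mulr0 add0r om_suml big1// => j _.
  by rewrite Xz mulr0.
by exists a; rewrite zE y0 linear0 addr0.
Qed.

(** On the common kernel of the differentials [alpha] takes real values, so
    that kernel is spanned by [X] and at most one further vector [t]. *)
Lemma kernel_frame : exists2 t, in_kernel t &
  forall z, in_kernel z -> exists c : 'I_n -> R,
    z = \sum_k c k *: frame X t k.
Proof.
have frameE t (c : 'I_m -> R) d : exists c' : 'I_n -> R,
    \sum_j c j *: X j + d *: t = \sum_k c' k *: frame X t k.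
  exists (fun k => if unlift ord_max k is Some j then c j else d).
  rewrite sum_frame frame_max unlift_none; congr (_ + _).
  by apply: eq_bigr => j _; rewrite frame_lift liftK.
have [[t [kt at0]]|no] := pselect (exists t, in_kernel t /\ alpha t != 0).
  exists t => // z [Xz Imz]; have [Xt Imt] := kt.
  have r0 : complex.Re (alpha t) != 0.
    by move: at0; rewrite eq_complex Imt eqxx andbT.
  pose r := complex.Re (alpha z) / complex.Re (alpha t).
  have [j||c zE] := @alpha_ker_real ((- r) *: t + z).
  - by rewrite om_linr Xt Xz mulr0 addr0.
  - apply/Phi_eq0; rewrite Re_alpha_lin Im_alpha_lin Imt Imz mulr0 addr0.
    by rewrite /r mulNr divfK// addNr.
  have [c' c'E] := frameE t c r; exists c'.
  by rewrite -c'E -zE scaleNr addrAC addNr add0r.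
have k0 : in_kernel 0.
  have a0 : alpha 0 = 0.
    by apply: alpha_span; apply: in_spanP; exact: sub0mx.
  split=> [j|]; last by rewrite a0.
  by have := om_linr 0 0 (-1) (X j); rewrite scaler0 addr0 mulN1r addNr.
exists 0 => // z kz; have [Xz _] := kz.
have az : alpha z = 0.
  by apply/eqP; apply: contrapT => /negP az; apply: no; exists z.
have [c ->] := alpha_ker_real Xz az.
by have [c' c'E] := frameE 0 c 0; exists c'; rewrite -c'E scaler0 addr0.
Qed.

(** The common kernel of the differentials of [(mu, xi)] is Lagrangian and
    special: it is spanned by the isotropic family [X] and one vector [t] in the
    kernel, and [Im Phi (X, t)] is the value of the last differential on [t]. *)
Lemma kernel_isotropic v : (forall l, in_kernel (v l)) -> o v = 0.
Proof.
move=> kv; have [t [Xt _] tspan] := kernel_frame.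
apply: (multilinear_span (e := frame X t)) => // [f|l]; last exact: tspan.
have -> : frame X t \o f = pair (frame X t (f ord0)) (frame X t (f ord_max)).
  apply/funext => j; case: j => [[|[|]]]//= j2; congr (frame X t (f _)).
    exact: val_inj.
  exact: val_inj.
rewrite /frame; case: unliftP => [i _|_]; case: unliftP => [j _|_] //.
- by rewrite om_antisym Xt oppr0.
- exact: om_diag.
Qed.

Lemma kernel_special v : (forall l, in_kernel (v l)) -> complex.Im (Phi v) = 0.
Proof.
move=> kv; have [t [_ Imt] tspan] := kernel_frame.
apply: (multilinear_span (e := frame X t) Im_ml) => [f|l]; last exact: tspan.
exact: alternating_reindex Im_ml Im_alt Imt.
Qed.

End RegularPoint.

(** * Level sets and critical sets *)

Section Charts.
Context {E M : topologicalType}.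

Lemma chart_preimage_open (c : chart E M) (B : set E) : open B ->
  open (chart_dom c `&` c @^-1` B).
Proof.
move=> oB; rewrite openE => p [cp Bp]; rewrite /interior.
apply: filterI.
  by apply: open_nbhs_nbhs; split=> //; exact: chart_dom_open.
by apply: (chart_fun_cont cp); exact: open_nbhs_nbhs.
Qed.

Lemma overlap_open (c d : chart E M) : open (overlap c d).
Proof.
rewrite openE => x [cx dx]; rewrite /interior.
apply: filterI.
  by apply: open_nbhs_nbhs; split=> //; exact: chart_cod_open.
apply: (chart_inv_cont cx).
by apply: open_nbhs_nbhs; split=> //; exact: chart_dom_open.
Qed.

Section ChangeOfCoordinates.
Context (c : chart E M) (G H : E -> E) (B : set E).
Hypotheses (oB : open B) (Bc : B `<=` chart_cod c) (oGB : open (G @` B)).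
Hypotheses (HG : forall x, B x -> H (G x) = x).
Hypotheses (cG : forall x, B x -> {for x, continuous G}).
Hypotheses (cH : forall y, (G @` B) y -> {for y, continuous H}).

Program Definition change_coordinates : chart E M := @Chart E M
  (chart_dom c `&` c @^-1` B) (G @` B) (fun p => G (c p))
  (fun y => chart_inv c (H y)) (chart_preimage_open c oB) oGB _ _ _ _ _ _.
Next Obligation. by move=> p [_ Bp]; exists (c p). Qed.
Next Obligation.
move=> _ [x Bx <-]; rewrite HG//; split; first exact/chart_invS/Bc.
by rewrite /= chart_invK//; exact: Bc.
Qed.
Next Obligation. by move=> p [cp Bp]; rewrite HG// chart_funK. Qed.
Next Obligation.
by move=> _ [x Bx <-]; rewrite HG// chart_invK//; exact: Bc.
Qed.
Next Obligation.
move=> p [cp Bp]; apply: (@continuous_comp _ _ _ c G); last exact: cG.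
exact: chart_fun_cont.
Qed.
Next Obligation.
move=> y Vy; apply: (@continuous_comp _ _ _ H (chart_inv c)); first exact: cH.
by apply: chart_inv_cont; case: Vy => x Bx <-; rewrite HG//; exact: Bc.
Qed.

End ChangeOfCoordinates.
End Charts.

Section Levels.
Context {R : realType} {n : nat} {M : complexManifold R n}.
Local Notation E := 'rV[R]_(n + n).

Lemma atlas_smooth_chart (i : atlas_index M) : smooth_chart (atlas i).
Proof.
move=> j; split; first by have [] := atlas_compat i j.
by have [] := atlas_compat j i.
Qed.

Lemma change_coordinates_smooth (c : chart E M) G H B oB Bc oGB HG cG cH :
  smooth_chart c -> smooth_on B G -> smooth_on (G @` B) H ->
  smooth_chart (@change_coordinates E M c G H B oB Bc oGB HG cG cH).
Proof.
move=> sc sG sH i; have [sci sic] := sc i; split.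
  apply: (smooth_on_comp (f := H) (g := transition c (atlas i))
    (U' := overlap c (atlas i))).
  - exact: overlap_open.
  - exact: overlap_open.
  - move=> y [[x Bx <-]]; rewrite /= HG// => di.
    by split; first exact: Bc.
  - by move=> k; apply: Ck_on_sub (sH k) => y [].
  - exact: sci.
apply: (smooth_on_comp (f := transition (atlas i) c) (g := G) (U' := B)) => //.
- exact: overlap_open.
- by move=> x [_ [_]].
- by move=> k; apply: Ck_on_sub (sic k) => x [ix [cx _]].
Qed.

(** If [D = L *m pid_mx p *m U] with [L] and [U] invertible, the last columns
    of [L] complete those of [D]. *)
Lemma complement_columns p (D : 'M[R]_(p + p, p)) : \rank D = p ->
  exists K : 'M[R]_(p + p, p), row_mx K D \in unitmx.
Proof.
move=> rD; set L := col_ebase D; exists (rsubmx L); apply: unitmx_inj => v.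
have DE : D = lsubmx L *m row_ebase D.
  rewrite -[LHS]mulmx_ebase rD pid_mx_col -/L -[L in LHS]hsubmxK.
  by rewrite mul_row_col mulmx1 mulmx0 addr0.
move=> vKD; have : row_mx (v *m rsubmx L) (v *m D) = row_mx 0 0.
  by rewrite -mul_mx_row vKD row_mx0.
move=> /eq_row_mx[vr]; rewrite DE mulmxA.
move=> /(congr1 (mulmx^~ (invmx (row_ebase D)))).
rewrite mul0mx mulmxK ?row_ebase_unit// => vl.
have : v *m L = 0 by rewrite -[L]hsubmxK mul_mx_row vl vr row_mx0.
move=> /(congr1 (mulmx^~ (invmx L))).
by rewrite mul0mx mulmxK//; exact: col_ebase_unit.
Qed.

(** In the chart at a point of the level set, completing [F - c] by linear
    functions that are independent of its differential gives a local
    diffeomorphism, hence new coordinates, of which the last ones cut out the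
    level set. *)
Lemma regular_level_submanifold (F : M -> 'rV[R]_n) (c : 'rV[R]_n) :
  (forall j, smooth_fun (fun q => F q 0 j)) ->
  (forall q, F q = c -> forall l : 'I_n -> R,
     (forall w, \sum_j l j * diff_fun (fun q => F q 0 j) q w = 0) ->
     forall j, l j = 0) ->
  submanifold n [set q | F q = c].
Proof.
move=> sF regF; split=> [|q /= Fq]; first exact: leq_addr.
pose c0 := chart_at q; pose x0 := c0 q.
pose U := chart_cod c0; pose f x := F (chart_inv c0 x).
have oU : open U by exact: chart_cod_open.
have qdom : chart_dom c0 q by exact: index_atP.
have Ux0 : U x0 by exact: chart_funS.
have sf : smooth_on U f.
  by move=> k; apply/Ck_on_rowP => // j; exact: (sF j (index_at q) k).
have df x : U x -> differentiable f x by have [+ _] := sf 1%N; exact.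
pose D := jacobian f x0.
have rD : \rank D = n.
  apply/eqP; rewrite -mxrank_tr; apply: inj_row_free => l lD.
  apply/rowP => j; rewrite mxE; apply: (regF q Fq (fun j => l 0 j)) => w.
  have : l *m D^T *m w^T = 0 by rewrite lD mul0mx.
  rewrite -mulmxA -trmx_mul => /matrixP/(_ 0 0); rewrite !mxE => lw.
  rewrite -[RHS]lw; apply: eq_bigr => i _; rewrite mxE -/D; congr (_ * _).
  rewrite -(deriveEjacobian _ (df _ Ux0)) -derive_coord//.
  exact: df.
have [K uKD] := complement_columns rD.
pose G x := row_mx ((x - x0) *m K) (f x - c).
have sG : smooth_on U G.
  move=> k; apply/Ck_on_rowP => // j; case: (split_ordP j) => i ->.
    have C1 := (Ck_on_rowP k _ oU).1 (smooth_mulmxr K oU k) i.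
    have C2 := Ck_onD oU C1 (Ck_on_cst k U (- (x0 *m K) 0 i)).
    apply: (eq_Ck_on oU _ C2) => x _.
    rewrite /G row_mxEl mulmxBl !fctE.
    by move: (x *m K) (x0 *m K) => A A'; rewrite !mxE.
  have C1 := (Ck_on_rowP k _ oU).1 (sf k) i.
  have C2 := Ck_onD oU C1 (Ck_on_cst k U (- c 0 i)).
  apply: (eq_Ck_on oU _ C2) => x _.
  by rewrite /G row_mxEr !mxE.
have dG x : U x -> differentiable G x by have [+ _] := sG 1%N; exact.
have JG : jacobian G x0 = row_mx K D.
  apply/row_matrixP => i; rewrite !rowE -(deriveEjacobian _ (dG _ Ux0)).
  set v := delta_mx 0 i; rewrite mul_mx_row -(deriveEjacobian _ (df _ Ux0)).
  have dx y : differentiable (fun x : E => x - x0) y.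
    by apply: differentiableB; [exact: ex_diff|exact: differentiable_cst].
  have dfc : differentiable (fun x => f x - c) x0.
    by apply: differentiableB; [exact: df|exact: differentiable_cst].
  apply/rowP => j; rewrite -(derive_coord _ _ _ (dG _ Ux0)).
  case: (split_ordP j) => k ->.
    rewrite row_mxEl.
    rewrite (_ : (fun y => _) = fun x => ((x - x0) *m K) 0 k); last first.
      by apply/funext => y; rewrite row_mxEl.
    have [dK DK] := derive_mulmxr K v (dx x0).
    rewrite (derive_coord _ _ _ dK) DK.
    by rewrite deriveB// derive_cst derive_id subr0.
  rewrite row_mxEr.
  rewrite (_ : (fun y => _) = fun x => (f x - c) 0 k); last first.
    by apply/funext => y; rewrite row_mxEr.
  rewrite (derive_coord _ _ _ dfc).
  rewrite deriveB ?derive_cst ?subr0//.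
  by apply: diff_derivable; exact: df.
have uJ : jacobian G x0 \in unitmx by rewrite JG.
have [B [H [[oB Bx0] BU oGB HG sH]]] := inverse_function_theorem oU Ux0 sG uJ.
have sGB : smooth_on B G by move=> k; exact: Ck_on_sub BU (sG k).
pose d := change_coordinates (c := c0) oB BU oGB HG (sGB 0%N) (sH 0%N).
exists d; split.
- by split.
- apply: change_coordinates_smooth => //; exact: atlas_smooth_chart.
- move=> p [c0p Bp] /=.
  have GE (j : 'I_n) : G (c0 p) 0 (rshift n j) = F p 0 j - c 0 j.
    by rewrite /G row_mxEr !mxE /f chart_funK.
  split=> [Fp j|Hp].
    case: (split_ordP j) => i ->; first by rewrite /= leqNgt ltn_ord.
    by move=> _; rewrite GE Fp subrr.
  apply/rowP => j; apply/eqP; rewrite -subr_eq0 -GE; apply/eqP.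
  by apply: Hp; rewrite /= leq_addr.
Qed.

Lemma smooth_fun_continuous (f : M -> R) : smooth_fun f -> continuous f.
Proof.
move=> sf p; pose c := atlas (index_at p).
have cp : chart_dom c p by exact: index_atP.
have cf := sf (index_at p) 0%N _ (chart_funS cp).
have h : f (chart_inv c (c q)) @[q --> p] --> f (chart_inv c (c p)).
  exact: continuous_comp (chart_fun_cont cp) cf.
rewrite (chart_funK cp) in h.
apply: cvg_trans h; apply: near_eq_cvg.
have : nbhs p (chart_dom c).
  by apply: open_nbhs_nbhs; split=> //; exact: chart_dom_open.
by apply: filterS => q cq /=; rewrite chart_funK.
Qed.

(** The chart [c] need not be the preferred one: the change of coordinates
    between the two carries a vanishing differential to a vanishing one. *)
Lemma derive_smooth_chart (f : M -> R) (c : chart E M) x (w : E) :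
  smooth_fun f -> smooth_chart c -> chart_cod c x ->
  (forall w', diff_fun f (chart_inv c x) w' = 0) ->
  differentiable (fun y => f (chart_inv c y)) x /\
  'D_w (fun y => f (chart_inv c y)) x = 0.
Proof.
move=> sf sc cx f0; set p := chart_inv c x; pose i := index_at p.
have ip : chart_dom (atlas i) p by exact: index_atP.
have [/(_ 1%N)[dt _] _] := sc i.
have ox : overlap c (atlas i) x by [].
have [dfi _] := sf i 1%N.
have dtx := dt _ ox; have dfx := dfi _ (chart_funS ip).
have near_eq : \forall y \near x,
    ((fun z => f (chart_inv (atlas i) z)) \o transition c (atlas i)) y =
    f (chart_inv c y).
  have : nbhs x (overlap c (atlas i)).
    by apply: open_nbhs_nbhs; split=> //; exact: overlap_open.
  by apply: filterS => y [_ iy] /=; rewrite /transition chart_funK.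
split.
  exact: near_eq_differentiable near_eq (differentiable_comp dtx dfx).
rewrite -(near_eq_derive _ near_eq) (derive_comp _ dtx dfx).
exact: f0.
Qed.

(** Such a function is constant along segments in the slice charts of [L],
    hence locally constant on [L]. *)
Lemma critical_constant k (L : set M) (f : M -> R) :
  smooth_fun f -> submanifold k L -> connected L ->
  (forall p, L p -> forall w, diff_fun f p w = 0) ->
  forall p q, L p -> L q -> f p = f q.
Proof.
move=> sf [_ sL] cL f0 p q Lp Lq.
suff LE : L `&` f @^-1` [set f p] = L.
  by have : L q by []; rewrite -LE => -[_ /= ->].
apply: cL; first by exists p.
- pose V r := [set z | exists2 C, open C /\ C z & L `&` C `<=` f @^-1` [set r]].
  exists (V (f p)).
    rewrite openE => z [C [oC Cz] LC].
    rewrite /interior; have : nbhs z C by exact: open_nbhs_nbhs.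
    by apply: filterS => y Cy; exists C.
  apply/seteqP; split=> [z [Lz fz]|z [Lz [C [_ Cz] LC]]]; last first.
    by split=> //; exact: LC.
  split=> //.
  have [c [cz sc slice]] := sL z Lz.
  have : nbhs (c z) (chart_cod c).
    by apply: open_nbhs_nbhs; split; [exact: chart_cod_open|exact: chart_funS].
  move=> /nbhs_ballP[r /= r0 Br].
  exists (chart_dom c `&` c @^-1` ball (c z) r).
    split; first exact/chart_preimage_open/ball_open.
    by split=> //; exact: ballxx.
  move=> y [Ly [cy By]] /=; rewrite -fz.
  pose g x := f (chart_inv c x).
  have Lseg t : 0 <= t <= 1 -> chart_cod c (c z + t *: (c y - c z)) /\
      L (chart_inv c (c z + t *: (c y - c z))).
    move=> t01; have cs : chart_cod c (c z + t *: (c y - c z)).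
      by apply/Br/ball_segment => //; exact: ballxx.
    split=> //; apply/slice; first exact: chart_invS.
    move=> j kj; rewrite chart_invK// !mxE.
    by rewrite (slice _ cy).1// (slice _ cz).1// subrr mulr0 addr0.
  have [t t01|t t01] := @mean_value _ _ g (c z) (c y).
    have [cs Ls] := Lseg t t01.
    by have [] := derive_smooth_chart (c y - c z) sf sc cs (f0 _ Ls).
  have [cs Ls] := Lseg t t01.
  have [_ ->] := derive_smooth_chart (c y - c z) sf sc cs (f0 _ Ls).
  by rewrite /g !chart_funK// => /eqP; rewrite subr_eq0 => /eqP.
- exists (f @^-1` [set f p]) => //.
  apply: closed_comp; last exact: closed_eq.
  by move=> z _; exact: smooth_fun_continuous.
Qed.

End Levels.

(** * Torus orbits *)

Section Curves.
Context {R : realType} {n : nat} {M : complexManifold R n}.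

(** By continuity [g] stays in the domain of the chart near time [0], so that
    the chain rule in that chart computes the derivative of [f \o g], a
    function which is constant near [0]. *)
Lemma diff_fun_constant_curve (f : M -> R) (g : R -> M) (p : M) :
  smooth_fun f -> {for 0, continuous g} -> g 0 = p ->
  differentiable (fun t => chart_at p (g t)) 0 ->
  (\forall t \near 0, f (g t) = f p) ->
  diff_fun f p (derive1 (fun t => chart_at p (g t)) 0) = 0.
Proof.
move=> sf cg g0 dg fg; pose c := atlas (index_at p).
have cp : chart_dom c p by exact: index_atP.
have [dfi _] := sf (index_at p) 1%N.
pose h x := f (chart_inv c x); pose l t := c (g t).
have dh : differentiable h (l 0).
  by apply: dfi; rewrite /l g0; exact: chart_funS.
have Dhl : 'D_1 (h \o l) 0 = 'D_('D_1 l 0) h (l 0) by exact: derive_comp.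
have lp : l 0 = c p by rewrite /l g0.
rewrite derive1E (_ : diff_fun _ _ _ = 'D_1 (h \o l) 0); last by rewrite Dhl lp.
have near_cst : \forall t \near 0, (h \o l) t = cst (f p) t.
  have near_dom : \forall t \near 0, chart_dom c (g t).
    apply: cg; rewrite g0; apply: open_nbhs_nbhs.
    by split=> //; exact: chart_dom_open.
  apply: filterS2 fg near_dom => t ft ct.
  by rewrite /h /l /= chart_funK.
by rewrite (near_eq_derive _ near_cst) derive_cst.
Qed.

Lemma tangent_to_level (f : M -> R) (L : set M) p w r : smooth_fun f ->
  (forall q, L q -> f q = r) -> tangent_to L p w -> diff_fun f p w = 0.
Proof.
move=> sf fL [e [g [e0 [cg sg] Lg g0 <-]]].
have near0 : \forall t \near (0 : R), `|t| < e.
  apply/nbhs_normP; exists e => // t /=.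
  by rewrite sub0r normrN.
have t0 : `|0 : R| < e by rewrite normr0.
have ip : chart_dom (atlas (index_at p)) p by exact: index_atP.
apply: diff_fun_constant_curve => //.
- exact: cg.
- by have [+ _] := sg (index_at p) 1%N; apply; split=> //=; rewrite g0.
- apply: filterS near0 => t te; rewrite (fL _ (Lg t te)) fL//.
  by rewrite -g0; exact: Lg.
Qed.

End Curves.

Section TorusAction.
Context {R : realType} {m n : nat} {M : complexManifold R n}.
Variable a : torusAction m M.

Lemma orbit_differentiable (v : 'rV[R]_m) (p : M) :
  differentiable (fun s : R => chart_at p (a (s *: v) p)) 0.
Proof.
pose i := index_at p; pose c := atlas i.
have cp : chart_dom c p by exact: index_atP.
pose g (tx : 'rV[R]_m * 'rV[R]_(n + n)) := c (a tx.1 (chart_inv c tx.2)).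
pose l (s : R) : 'rV[R]_m * 'rV[R]_(n + n) := (s *: v, c p).
have dl : differentiable l 0.
  apply: differentiable_pair; last exact: differentiable_cst.
  by apply: (@differentiableZl _ _ _ id v); exact: ex_diff.
have dg : differentiable g (l 0).
  have [+ _] := @act_smooth _ _ _ _ a i i 1%N; apply; split=> /=.
    exact: chart_funS.
  by rewrite scale0r act0 chart_funK.
have -> : (fun s : R => chart_at p (a (s *: v) p)) = g \o l.
  by apply/funext => s; rewrite /g /l /= chart_funK.
exact: differentiable_comp.
Qed.

Lemma orbit_continuous (v : 'rV[R]_m) (p : M) :
  {for 0, continuous (fun s : R => a (s *: v) p)}.
Proof.
apply: (@continuous_comp _ _ _ (fun s : R => (s *: v, p))
  (fun tp : 'rV[R]_m * M => a tp.1 tp.2)); last exact: act_continuous.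
have cs : {for 0, continuous (fun s : R => s *: v)}.
  apply: differentiable_continuous.
  by apply: (@differentiableZl _ _ _ id v); exact: ex_diff.
have cp : {for 0, continuous (fun s : R => p)} by exact: cst_continuous.
exact: (cvg_pair cs cp).
Qed.

Lemma invariant_diff_fun (f : M -> R) (v : 'rV[R]_m) (p : M) :
  smooth_fun f -> (forall t q, f (a t q) = f q) ->
  diff_fun f p (induced_field a v p) = 0.
Proof.
move=> sf inv; apply: diff_fun_constant_curve => //.
- exact: orbit_continuous.
- by rewrite scale0r act0.
- exact: orbit_differentiable.
- by apply: filterE => s; rewrite inv.
Qed.

Lemma induced_field_fixed (v : 'rV[R]_m) (p : M) :
  (forall s : R, a (s *: v) p = p) -> induced_field a v p = 0.
Proof.
move=> fixp; rewrite /induced_field.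
rewrite (_ : (fun s => _) = cst (chart_at p p)) ?derive1_cst//.
by apply/funext => s; rewrite fixp.
Qed.

End TorusAction.

(** * Planes of codimension two *)

Section Plane.
Context {R : realType} {m : nat}.

(** The plane is the translate to [x0] of the kernel of the two linear forms;
    [c j0 != 0] makes them independent, and forces [0 < m]. *)
Lemma codim2_plane (c : 'I_m -> R) (j0 : 'I_m) (x0 : 'rV[R]_m.+1) :
  c j0 != 0 ->
  exists P : set 'rV[R]_m.+1,
    (exists2 d, d.+2 = m.+1 & affine_plane d P) /\
    forall x : 'rV[R]_m.+1, \sum_j c j * x 0 (lift ord_max j) =
              \sum_j c j * x0 0 (lift ord_max j) ->
      x 0 ord_max = x0 0 ord_max -> P x.
Proof.
move=> cj0.
pose C : 'M[R]_(m.+1, 2) := \matrix_(k, l)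
  if l == 0 then (if unlift ord_max k is Some j then c j else 0)
  else (k == ord_max)%:R.
pose f : 'Hom('rV[R]_m.+1, 'rV[R]_2) := linfun (mulmxr C).
have fE (x : 'rV[R]_m.+1) l :
    f x 0 l = if l == 0 then \sum_j c j * x 0 (lift ord_max j)
              else x 0 ord_max.
  rewrite lfunE /= mxE sum_frame !mxE unlift_none eqxx.
  case: ifP => l0.
    rewrite mulr0 addr0; apply: eq_bigr => j _.
    by rewrite !mxE l0 liftK mulrC.
  rewrite mulr1 big1 ?add0r// => j _.
  by rewrite !mxE l0 eq_sym (negbTE (neq_lift _ _)) mulr0.
have f_surj : limg f = fullv.
  apply/eqP; rewrite eqEsubv subvf; apply/subvP => y _.
  pose x : 'rV[R]_m.+1 := \row_k
    if unlift ord_max k is Some j then (if j == j0 then y 0 0 / c j0 else 0)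
    else y 0 1.
  have -> : y = f x.
    apply/rowP => l; rewrite fE; case: eqP => [->|l0]; last first.
      rewrite mxE unlift_none; congr (y 0 _); apply: val_inj.
      case: l l0 => [[|[|//]]]//= l2 l0.
      by case: l0; exact: val_inj.
    rewrite (bigD1 j0)//= big1 => [|j jj0]; last first.
      by rewrite mxE liftK (negbTE jj0) mulr0.
    by rewrite mxE liftK eqxx addr0 mulrC divfK.
  exact: memv_img (memvf _).
exists [set x | x - x0 \in lker f]; split.
  have m_gt0 : (0 < m)%N := leq_ltn_trans (leq0n j0) (ltn_ord j0).
  exists m.-1; first by rewrite prednK.
  exists x0, (lker f); split=> //.
  have := limg_ker_dim f fullv; rewrite capfv f_surj !dimvf /dim /= !mul1n.
  by rewrite addn2 => -[dE]; apply: succn_inj; rewrite prednK.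
move=> x sE lE; rewrite /= memv_ker; apply/eqP/rowP => l.
rewrite fE mxE; case: eqP => _; last by rewrite !mxE lE subrr.
under eq_bigr do rewrite !mxE mulrBr.
by rewrite sumrB sE subrr mxE.
Qed.

End Plane.

(** * The moment map *)

Section MomentMap.
Context {R : realType} {m : nat} {M : complexManifold R m.+1}.
Local Notation E := 'rV[R]_(m.+1 + m.+1).
Context (omega : M -> ('I_2 -> E) -> R) (phi : M -> ('I_m.+1 -> E) -> R[i]).
Context (a : torusAction m M) (mu : M -> 'Hom('rV[R]_m, R^o)).
Context (b : m.-tuple 'rV[R]_m) (xi : M -> R).
Hypotheses (omega_kahler : kahler_form omega)
  (phi_volume : holomorphic_volume_form phi) (mu_moment : moment_map a omega mu)
  (b_basis : basis_of fullv b) (xi_smooth : smooth_fun xi)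
  (dxi : forall p w,
     diff_fun xi p w = complex.Im (contracted_form a b phi p w)).

Lemma omega_multilinear p : multilinear (omega p).
Proof. by case: omega_kahler => -[]. Qed.

Lemma omega_alternating p : Defs.alternating (omega p).
Proof. by case: omega_kahler => -[]. Qed.

Lemma omega_positive p (v : E) :
  v != 0 -> 0 < omega p (tnth [tuple v; mulI v]).
Proof. by case: omega_kahler => _ _ _; exact. Qed.

Lemma mu_smooth v : smooth_fun (fun q => mu q v : R).
Proof. by case: mu_moment. Qed.

Lemma diff_muE v p w : diff_fun (fun q => mu q v : R) p w =
  omega p (tnth [tuple induced_field a v p; w]).
Proof. by case: mu_moment. Qed.

(** [X_v] depends linearly on [v] because [mu] does and [omega] is
    nondegenerate. *)
Lemma induced_field_linear p : linear (induced_field a ^~ p).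
Proof.
move=> c u v; pose muc z x : R := mu (chart_inv (chart_at p) x) z.
have d z w : derivable (muc z) (chart_at p p) w.
  apply: diff_derivable; have [+ _] := mu_smooth z (index_at p) 1%N; apply.
  exact/chart_funS/index_atP.
have D w : diff_fun (fun q => mu q (c *: u + v) : R) p w =
    c * diff_fun (fun q => mu q u : R) p w + diff_fun (fun q => mu q v : R) p w.
  rewrite /diff_fun -!/(muc _).
  have -> : muc (c *: u + v) = (c \*: muc u) + muc v.
    by apply/funext => x; rewrite /muc linearP.
  rewrite (deriveD (derivableZ (k := c) (d u w)) (d v w)).
  by rewrite (deriveZ c (d u w)).
apply: (om_nondegenerate (@omega_multilinear p) (@omega_positive p)) => w.
by move: (D w); rewrite (diff_muE (c *: u + v)) (diff_muE u) (diff_muE v).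
Qed.

Lemma omega_orbit u v p :
  omega p (tnth [tuple induced_field a u p; induced_field a v p]) = 0.
Proof.
rewrite -diff_muE; apply: invariant_diff_fun; first exact: mu_smooth.
by move=> t q; case: mu_moment => ->.
Qed.

(** The innermost contraction is by the last basis vector and fills the first
    slot, hence the reversal. *)
Definition orbit_frame p (j : 'I_m) : E :=
  induced_field a (tnth b (rev_ord j)) p.

Lemma contracted_formE p w :
  contracted_form a b phi p w = phi p (frame (orbit_frame p) w).
Proof. by []. Qed.

Lemma sum_orbit_frame p (c : 'I_m -> R) :
  \sum_j c j *: orbit_frame p j =
  induced_field a (\sum_j c (rev_ord j) *: tnth b j) p.
Proof.
have lin0 : induced_field a 0 p = 0.
  have := induced_field_linear p (-1) 0 0.
  by rewrite scaler0 addr0 scaleN1r addNr.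
rewrite (reindex_inj rev_ord_inj) /=.
elim/big_rec2: _ => [//|j y1 y2 _ ->].
by rewrite induced_field_linear /orbit_frame rev_ordK.
Qed.

Lemma basis_coords (v : 'rV[R]_m) : v = \sum_j coord b j v *: tnth b j.
Proof.
have /andP[/eqP spanb _] := b_basis.
rewrite [LHS](@coord_span _ _ _ b); last by rewrite spanb memvf.
by apply: eq_bigr => j _; rewrite (tnth_nth 0).
Qed.

Lemma orbit_frame_free p : regular_point a p ->
  forall c, \sum_j c j *: orbit_frame p j = 0 -> forall j, c j = 0.
Proof.
move=> reg c; rewrite sum_orbit_frame => X0 j.
have lin0 : induced_field a 0 p = 0.
  have := induced_field_linear p (-1) 0 0.
  by rewrite scaler0 addr0 scaleN1r addNr.
have /freeP fb := basis_free b_basis.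
rewrite -[j]rev_ordK; apply: (fb (fun j => c (rev_ord j))).
have := reg _ _ (etrans X0 (esym lin0)) => bE; rewrite -[RHS]bE.
by apply: eq_bigr => i _; rewrite (tnth_nth 0).
Qed.

Lemma phi_Re_multilinear p : multilinear (fun v => complex.Re (phi p v)).
Proof. by case: phi_volume => -[[]]. Qed.

Lemma phi_Re_alternating p : Defs.alternating (fun v => complex.Re (phi p v)).
Proof. by case: phi_volume => -[[]]. Qed.

Lemma phi_Im_multilinear p : multilinear (fun v => complex.Im (phi p v)).
Proof. by case: phi_volume => -[_ []]. Qed.

Lemma phi_Im_alternating p : Defs.alternating (fun v => complex.Im (phi p v)).
Proof. by case: phi_volume => -[_ []]. Qed.

Lemma phi_complex p v l : phi p (dfwith v l (mulI (v l))) = 'i%C * phi p v.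
Proof. by case: phi_volume. Qed.

Lemma phi_neq0 p : exists v, phi p v != 0.
Proof. by case: phi_volume. Qed.

Lemma moment_xi_lift q j :
  moment_xi b mu xi q 0 (lift ord_max j) = mu q (tnth b j).
Proof. by rewrite mxE liftK. Qed.

Lemma moment_xi_max q : moment_xi b mu xi q 0 ord_max = xi q.
Proof. by rewrite mxE unlift_none. Qed.

Lemma regular_fiber_special_lagrangian r :
  (forall q, moment_xi b mu xi q = r -> regular_point a q) ->
  special_lagrangian omega phi [set q | moment_xi b mu xi q = r].
Proof.
move=> reg.
have iso q i j :
    omega q (tnth [tuple orbit_frame q i; orbit_frame q j]) = 0.
  exact: omega_orbit.
have ker q v : moment_xi b mu xi q = r ->
    tangent_to [set q | moment_xi b mu xi q = r] q v ->
    in_kernel (omega q) (phi q) (orbit_frame q) v.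
  move=> Fq tv; split=> [j|].
    rewrite /orbit_frame -diff_muE.
    apply: (tangent_to_level (r := r 0 (lift ord_max (rev_ord j))) _ _ tv).
      exact: mu_smooth.
    by move=> q' <-; rewrite moment_xi_lift.
  rewrite -contracted_formE -dxi.
  apply: (tangent_to_level (r := r 0 ord_max) _ _ tv) => //.
  by move=> q' <-; rewrite moment_xi_max.
have FE j : (fun q => moment_xi b mu xi q 0 (lift ord_max j)) =
    (fun q => mu q (tnth b j) : R).
  by apply/funext => q; rewrite moment_xi_lift.
have Fmax : (fun q => moment_xi b mu xi q 0 ord_max) = xi.
  by apply/funext => q; rewrite moment_xi_max.
split.
- apply: regular_level_submanifold => [k|q Fq l H].
    case: (unliftP ord_max k) => [j ->|->]; last by rewrite Fmax.
    by rewrite FE; exact: mu_smooth.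
  have [|l0 d0] := @differentials_free _ _ _ _ _
      (@omega_multilinear q) (@omega_positive q)
      (@phi_Re_multilinear q) (@phi_Re_alternating q)
      (@phi_Im_multilinear q) (@phi_Im_alternating q)
      (@phi_complex q) (phi_neq0 q) (orbit_frame_free (reg q Fq)) (iso q)
      (fun j => l (lift ord_max (rev_ord j))) (l ord_max).
    move=> w; rewrite -[RHS](H w) sum_frame; congr (_ + _).
      rewrite [RHS](reindex_inj rev_ord_inj) /=; apply: eq_bigr => j _.
      by rewrite FE diff_muE.
    by rewrite -contracted_formE -dxi Fmax.
  move=> k; case: (unliftP ord_max k) => [j ->|->//].
  by have := l0 (rev_ord j); rewrite rev_ordK.
- move=> q v Fq tv.
  apply: (kernel_isotropic (@omega_multilinear q) (@omega_alternating q)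
      (@omega_positive q)
      (@phi_Re_multilinear q) (@phi_Re_alternating q)
      (@phi_Im_multilinear q) (@phi_Im_alternating q)
      (@phi_complex q) (phi_neq0 q) (orbit_frame_free (reg q Fq)) (iso q)).
  by move=> l; exact: ker.
- move=> q v Fq tv.
  apply: (kernel_special (@omega_multilinear q)
      (@omega_positive q)
      (@phi_Re_multilinear q) (@phi_Re_alternating q)
      (@phi_Im_multilinear q) (@phi_Im_alternating q)
      (@phi_complex q) (phi_neq0 q) (orbit_frame_free (reg q Fq)) (iso q)).
  by move=> l; exact: ker.
Qed.

(** On a connected submanifold fixed by the one-parameter group of [v], both
    [mu v] and [xi] are critical: [X_v = 0] there, and the frame that enters the
    contraction defining [xi] is linearly dependent. *)
Lemma fixed_submanifold_image k (S : set M) (v : 'rV[R]_m) :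
  connected S -> submanifold k S -> v != 0 ->
  (forall s p, S p -> a (s *: v) p = p) ->
  exists P : set 'rV[R]_m.+1,
    (exists2 d, d.+2 = m.+1 & affine_plane d P) /\
    forall q, S q -> P (moment_xi b mu xi q).
Proof.
move=> cS sS v0 fixS.
have [j0 cj0] : exists j0, coord b j0 v != 0.
  apply: contrapT => H; move/eqP: v0; apply; rewrite (basis_coords v).
  apply: big1 => j _; have [->|cj] := eqVneq (coord b j v) 0.
    by rewrite scale0r.
  by case: H; exists j.
have Xv q : S q -> induced_field a v q = 0.
  by move=> Sq; apply: induced_field_fixed => s; exact: fixS.
have mu_const p q : S p -> S q -> mu p v = mu q v.
  apply: (critical_constant (f := fun q => mu q v : R) (mu_smooth v) sS cS).
  move=> {}p Sp w; rewrite diff_muE Xv//.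
  have := om_linl (@omega_multilinear p) 0 0 (-1) w.
  by rewrite scaler0 addr0 mulN1r addNr.
have xi_const p q : S p -> S q -> xi p = xi q.
  apply: (critical_constant xi_smooth sS cS) => {}p Sp w.
  rewrite dxi contracted_formE.
  apply: (alternating_dependent (l := lift ord_max (rev_ord j0))
    (@phi_Im_multilinear p) (@phi_Im_alternating p)).
  exists (fun k => if unlift ord_max k is Some j then coord b (rev_ord j) v
                   else 0); first by rewrite liftK rev_ordK.
  rewrite sum_frame unlift_none scale0r addr0.
  under eq_bigr do rewrite liftK frame_lift.
  rewrite sum_orbit_frame; under eq_bigr do rewrite rev_ordK.
  by rewrite -basis_coords Xv.
have [[q0 Sq0]|S0] := pselect (exists q, S q); last first.
  (* An empty [S] lies in any plane of the required dimension. *)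
  have [P [HP _]] := codim2_plane (c := fun j => coord b j v) 0 cj0.
  by exists P; split=> // q Sq; case: S0; exists q.
have [P [HP PE]] := codim2_plane (c := fun j => coord b j v)
  (moment_xi b mu xi q0) cj0.
exists P; split=> // q Sq.
have muE q' : \sum_j coord b j v * moment_xi b mu xi q' 0 (lift ord_max j) =
    mu q' v.
  rewrite [in RHS](basis_coords v) linear_sum; apply: eq_bigr => j _.
  by rewrite linearZ moment_xi_lift.
apply: PE; first by rewrite !muE (mu_const q q0).
by rewrite !moment_xi_max (xi_const q q0).
Qed.

End MomentMap.

Unset Implicit Arguments.

Theorem theorem3 (R : realType) (m : nat)
  (M : complexManifold R m.+1)
  (omega : M -> ('I_2 -> 'rV[R]_(m.+1 + m.+1)) -> R)
  (phi : M -> ('I_m.+1 -> 'rV[R]_(m.+1 + m.+1)) -> R[i])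
  (a : torusAction m M)
  (mu : M -> 'Hom('rV[R]_m, R^o))
  (b : m.-tuple 'rV[R]_m)
  (xi : M -> R)
  (N : nat) (S : 'I_N -> set M) :
  kahler_form omega ->
  holomorphic_volume_form phi ->
  effective a ->
  preserves a omega ->
  preserves a phi ->
  moment_map a omega mu ->
  H1_vanishes M ->
  basis_of fullv b ->
  smooth_fun xi ->
  (forall p w, diff_fun xi p w = complex.Im (contracted_form a b phi p w)) ->
  [set p | ~ regular_point a p] = \bigcup_i S i ->
  (forall i, connected (S i) /\ exists k, submanifold k (S i)) ->
  (forall i, exists2 K, stabilizing_subgroup a (S i) K
                      & positive_dimensional K) ->
  exists (N' : nat) (H : 'I_N' -> set 'rV[R]_m.+1),
    (forall i, exists2 d, d.+2 = m.+1 & affine_plane d (H i)) /\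
    forall p, ~ (\bigcup_i H i) p ->
      special_lagrangian omega phi [set q | moment_xi b mu xi q = p].
Proof.
move=> omega_kahler phi_volume _ _ _ mu_moment _ b_basis xi_smooth dxi.
move=> nonreg subS stabS.
have /choice[H HP] : forall i, exists P : set 'rV[R]_m.+1,
    (exists2 d, d.+2 = m.+1 & affine_plane d P) /\
    forall q, S i q -> P (moment_xi b mu xi q).
  move=> i; have [cS [k sS]] := subS i.
  have [K [_ _ _ fixK] [v v0 Kv]] := stabS i.
  apply: (fixed_submanifold_image omega_kahler phi_volume mu_moment b_basis
    xi_smooth dxi cS sS v0).
  by move=> s p; exact: fixK.
exists N, H; split=> [i|p pH]; first by have [] := HP i.
apply: (regular_fiber_special_lagrangian omega_kahler phi_volume mu_moment
  b_basis xi_smooth dxi) => q Fq.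
apply: contrapT => nreg.
have : (\bigcup_i S i) q by rewrite -nonreg.
move=> [i _ Siq]; apply: pH; exists i => //.
by rewrite -Fq; have [_] := HP i; exact.
Qed.
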